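(* Let $A$ and $B$ be positive definite operators on a Hilbert space $H$. For $r\geqslant 0$, $t\geqslant 0$, $p\geqslant 1$ and a nonnegative integer $n$ such that $(p+t)s+r=(n+1)(1+t+r)$ (so, $s\geqslant \frac{1+t}{p+t}$), the following assertions are equivalent. (C1) $A\geqslant B>0$. (C2) $A^{1+t+r}\geqslant \left(A^{r/2}(A^{t/2}B^{p}A^{t/2})^{s}A^{r/2}\right)^{\frac{1}{n+1}}$. (C3) $\left(B^{r/2}(B^{t/2}A^{p}B^{t/2})^{s}B^{r/2}\right)^{\frac{1}{n+1}}\geqslant B^{1+t+r}$. (C4) There exists a unique $S>0$ with $\|S\|\leqslant 1$ such that $$B^{p}=A^{-\frac t2}\left(A^{\frac{1+t}{2}}(SA^{1+t+r})^{n}SA^{\frac{1+t}{2}}\right)^{\frac1s}A^{-\frac t2}=A^{-\frac t2}\left(A^{\frac{1+t}{2}}S(A^{1+t+r}S)^{n}A^{\frac{1+t}{2}}\right)^{\frac1s}A^{-\frac t2}.$$ (C5) There exists a unique $S>0$ with $\|S\|\leqslant 1$ such that $$A^{p}=B^{-\frac t2}\left(B^{\frac{1+t}{2}}(S^{-1}B^{1+t+r})^{n}S^{-1}B^{\frac{1+t}{2}}\right)^{\frac1s}B^{-\frac t2}=B^{-\frac t2}\left(B^{\frac{1+t}{2}}S^{-1}(B^{1+t+r}S^{-1})^{n}B^{\frac{1+t}{2}}\right)^{\frac1s}B^{-\frac t2}.$$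
   Context: Operators are bounded linear operators on a Hilbert space $H$. An operator $X$ is positive, $X\geqslant 0$, if $\langle Xx,x\rangle\geqslant 0$ for all $x\in H$; $X\geqslant Y$ means that $X,Y$ are self-adjoint and $X-Y\geqslant 0$. $X>0$ means that $X$ is positive definite (positive and invertible). Real powers of positive definite operators are taken by the continuous functional calculus; $\|\cdot\|$ is the operator norm. *)

(* Defs.v *)
From HB Require Import structures.
From mathcomp Require Import all_boot all_order all_algebra.
From mathcomp Require Import complex.
From mathcomp Require Import boolp classical_sets functions reals topology.
From mathcomp Require Import normedtype exp.

Set Implicit Arguments.
Unset Strict Implicit.
Unset Printing Implicit Defensive.

Import Order.TTheory GRing.Theory Num.Theory.

Local Open Scope classical_set_scope.
Local Open Scope ring_scope.

(* The norm of a normed module over R[i] takes its values in R[i], as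
   nonnegative reals. *)
Structure hilbertSpace (R : realType) := HilbertSpace {
  hilbert_sort :> completeNormedModType R[i] ;
  inner : {dot hilbert_sort for Num.conj} ;
  innerE : forall x : hilbert_sort, inner x x = `|x| ^+ 2 }.

Arguments inner {R h}.

Section BoundedOperators.
Variables (R : realType) (H : hilbertSpace R).

Record operator := Operator {
  operator_fun :> H -> H ;
  operator_linear : linear operator_fun ;
  operator_bounded : exists M : R[i], forall x, `|operator_fun x| <= M * `|x| }.

HB.instance Definition _ := gen_eqMixin operator.
HB.instance Definition _ := gen_choiceMixin operator.
HB.instance Definition _ (T : operator) :=
  GRing.isLinear.Build R[i] H H _ (operator_fun T) (operator_linear T).

Lemma operatorP (S T : operator) : (forall x, S x = T x) -> S = T.
Proof.
case: S T => [S Sl Sb] [T Tl Tb] /= /funext eST; subst T.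
by congr Operator; exact: Prop_irrelevance.
Qed.

Lemma operator_bounded_ge0 (T : operator) :
  exists2 M : R[i], 0 <= M & forall x, `|T x| <= M * `|x|.
Proof.
have [M TM] := operator_bounded T; exists `|M|; first exact: normr_ge0.
move=> x; have Mx : 0 <= M * `|x| by apply: le_trans (TM x).
by apply: le_trans (TM x) _; rewrite -(ger0_norm Mx) normrM normr_id.
Qed.

Fact zero_linear : linear (fun _ : H => 0 : H).
Proof. by move=> a x y; rewrite scaler0 addr0. Qed.
Fact zero_bounded : exists M : R[i], forall x : H, `|0 : H| <= M * `|x|.
Proof. by exists 0 => x; rewrite normr0 mul0r. Qed.
Definition operator0 := Operator zero_linear zero_bounded.

Fact one_linear : linear (fun x : H => x).
Proof. by []. Qed.
Fact one_bounded : exists M : R[i], forall x : H, `|x| <= M * `|x|.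
Proof. by exists 1 => x; rewrite mul1r. Qed.
Definition operator1 := Operator one_linear one_bounded.

Fact opp_linear (T : operator) : linear (fun x => - T x).
Proof. by move=> a x y; rewrite linearP opprD scalerN. Qed.
Fact opp_bounded (T : operator) :
  exists M : R[i], forall x, `|- T x| <= M * `|x|.
Proof.
by have [M TM] := operator_bounded T; exists M => x; rewrite normrN.
Qed.
Definition operator_opp T := Operator (opp_linear T) (opp_bounded T).

Fact add_linear (S T : operator) : linear (fun x => S x + T x).
Proof. by move=> a x y; rewrite !linearP scalerDr addrACA. Qed.
Fact add_bounded (S T : operator) :
  exists M : R[i], forall x, `|S x + T x| <= M * `|x|.
Proof.
have [M SM] := operator_bounded S; have [N TN] := operator_bounded T.
exists (M + N) => x; rewrite mulrDl.
by apply: le_trans (ler_normD _ _) _; exact: lerD.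
Qed.
Definition operator_add S T := Operator (add_linear S T) (add_bounded S T).

Fact scale_linear (c : R[i]) (T : operator) : linear (fun x => c *: T x).
Proof. by move=> a x y; rewrite linearP scalerDr !scalerA mulrC. Qed.
Fact scale_bounded (c : R[i]) (T : operator) :
  exists M : R[i], forall x, `|c *: T x| <= M * `|x|.
Proof.
have [M TM] := operator_bounded T; exists (`|c| * M) => x.
by rewrite normrZ -mulrA ler_wpM2l.
Qed.
Definition operator_scale c T :=
  Operator (scale_linear c T) (scale_bounded c T).

Fact comp_linear (S T : operator) : linear (fun x => S (T x)).
Proof. by move=> a x y; rewrite !linearP. Qed.
Fact comp_bounded (S T : operator) :
  exists M : R[i], forall x, `|S (T x)| <= M * `|x|.
Proof.
have [M M0 SM] := operator_bounded_ge0 S; have [N TN] := operator_bounded T.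
exists (M * N) => x; apply: le_trans (SM _) _.
by rewrite -mulrA ler_wpM2l.
Qed.
Definition operator_mul S T := Operator (comp_linear S T) (comp_bounded S T).

Fact operator_addA : associative operator_add.
Proof. by move=> S T U; apply: operatorP => x /=; rewrite addrA. Qed.
Fact operator_addC : commutative operator_add.
Proof. by move=> S T; apply: operatorP => x /=; rewrite addrC. Qed.
Fact operator_add0 : left_id operator0 operator_add.
Proof. by move=> T; apply: operatorP => x /=; rewrite add0r. Qed.
Fact operator_addN : left_inverse operator0 operator_opp operator_add.
Proof. by move=> T; apply: operatorP => x /=; rewrite addNr. Qed.
HB.instance Definition _ := GRing.isZmodule.Build operator
  operator_addA operator_addC operator_add0 operator_addN.

Fact operator_mulA : associative operator_mul.
Proof. by move=> S T U; apply: operatorP. Qed.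
Fact operator_mul1 : left_id operator1 operator_mul.
Proof. by move=> T; apply: operatorP. Qed.
Fact operator_mulr1 : right_id operator1 operator_mul.
Proof. by move=> T; apply: operatorP. Qed.
Fact operator_mulDl : left_distributive operator_mul +%R.
Proof. by move=> S T U; apply: operatorP. Qed.
Fact operator_mulDr : right_distributive operator_mul +%R.
Proof. by move=> S T U; apply: operatorP => x /=; rewrite linearD. Qed.
(* H may be the zero space, so this ring need not satisfy 1 != 0. *)
HB.instance Definition _ := GRing.Zmodule_isPzRing.Build operator
  operator_mulA operator_mul1 operator_mulr1 operator_mulDl operator_mulDr.

Fact operator_scaleA a b T :
  operator_scale a (operator_scale b T) = operator_scale (a * b) T.
Proof. by apply: operatorP => x /=; rewrite scalerA. Qed.
Fact operator_scale1 : left_id 1 operator_scale.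
Proof. by move=> T; apply: operatorP => x /=; rewrite scale1r. Qed.
Fact operator_scaleDr : right_distributive operator_scale +%R.
Proof. by move=> a S T; apply: operatorP => x /=; rewrite scalerDr. Qed.
Fact operator_scaleDl T : {morph operator_scale^~ T : a b / a + b}.
Proof. by move=> a b; apply: operatorP => x /=; rewrite scalerDl. Qed.
HB.instance Definition _ := GRing.Zmodule_isLmodule.Build R[i] operator
  operator_scaleA operator_scale1 operator_scaleDr operator_scaleDl.

Definition operator_norm (T : operator) : R :=
  sup [set complex.Re `|T x| | x in [set x : H | `|x| <= 1]].

(* That is, T is equal to its adjoint. *)
Definition selfadjoint (T : operator) :=
  forall x y : H, inner (T x) y = inner x (T y).

(* In R[i], 0 <= z means that z is real and nonnegative. *)
Definition positive (T : operator) := forall x : H, 0 <= inner (T x) x.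

Definition operator_ge (X Y : operator) :=
  [/\ selfadjoint X, selfadjoint Y & positive (X - Y)].

Definition is_inverse (T U : operator) := U * T = 1 /\ T * U = 1.

Definition invertible (T : operator) := exists U, is_inverse T U.

Definition operator_inv (T : operator) : operator := xget 0 (is_inverse T).

Definition positive_definite (T : operator) := positive T /\ invertible T.

Definition spectrum (T : operator) : set R[i] :=
  [set l | ~ invertible (T - l *: (1 : operator))].

Definition poly_operator (p : {poly R}) (T : operator) : operator :=
  \sum_(i < size p) (p`_i)%:C%C *: T ^+ i.

(* The continuous functional calculus of a selfadjoint T (whose spectrum is
   real): f(T) is the norm limit of p(T) for polynomials p converging to f
   uniformly on the spectrum. Such an operator exists and is unique when f is
   continuous on the spectrum, by the Weierstrass theorem and the isometry
   ||p(T)|| = sup |p| over the spectrum; otherwise fcalc is a junk value. *)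
Definition is_fcalc (f : R -> R) (T X : operator) :=
  forall e : R, 0 < e -> exists p : {poly R},
    (forall x : R, spectrum T x%:C%C -> `|p.[x] - f x| <= e) /\
    operator_norm (poly_operator p T - X) <= e.

Definition fcalc (f : R -> R) (T : operator) : operator :=
  xget 0 (is_fcalc f T).

Definition operator_power (T : operator) (a : R) : operator :=
  fcalc (fun x => x `^ a) T.

End BoundedOperators.

Notation "T ^^ a" := (operator_power T a)
  (at level 29, left associativity) : ring_scope.

Notation "X >=% Y" := (operator_ge X Y)
  (at level 70, no associativity) : ring_scope.

Definition admissible (R : realType) (r t p s : R) (n : nat) :=
  [/\ 0 <= r, 0 <= t, 1 <= p & (p + t) * s + r = n.+1%:R * (1 + t + r)].

(* Main.v *)
Require Import Defs.
From mathcomp Require Import all_boot all_order all_algebra.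
From mathcomp Require Import complex.
From mathcomp Require Import boolp classical_sets functions reals topology.
From mathcomp Require Import normedtype sequences exp.
From mathcomp Require Import ring lra.

(** The order statement A >= B is turned into the statements about words in
    powers of A and B by two applications of Furuta's inequality: for
    A >= B > 0, p >= 1 and r >= 0,
      A^(1+r) >= (A^(r/2) B^p A^(r/2))^((1+r)/(p+r)).
    The first one, with exponents p and t, compares A^(1+t) with a power of
    A^(t/2) B^p A^(t/2); the second one compares powers of these two operators.
    The relation (p+t)s+r = (n+1)(1+t+r) says precisely that the resulting outer
    exponent is 1/(n+1) [grand_furuta]. The inequality with the roles of A and B
    exchanged is the same statement for the inverses, since inversion reverses
    the order [operator_ge_inv, grand_furuta_dual].

    For the last two statements put D = A^(1+t+r) and let K be the word
    A^(r/2) (A^(t/2) B^p A^(t/2))^s A^(r/2). Multiplying the equation for S by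
    suitable powers of A turns it into (D^(1/2) S D^(1/2))^(n+1) = K; as positive
    roots are unique, S = D^(-1/2) K^(1/(n+1)) D^(-1/2) is its only positive
    definite solution [word_equation]. The condition ||S|| <= 1, that is S <= 1,
    then says K^(1/(n+1)) <= D. Conversely each of the four statements, taken at
    r = t = 0, p = s = 1 and n = 0, reads A >= B.

    Furuta's inequality is proved for r <= 1 by rewriting (XY)^l as
    X (YX)^(l-1) Y and using that powers with exponent in [0, 1] preserve the
    order [loewner_heinz]; composing it with the case r = 1 doubles 1 + r, which
    reaches all r [furuta_inequality]. The set of exponents preserving A >= B contains 0
    and 1, is closed, and is stable under midpoints: for the midpoint g of s and
    s', the operator A^(-g/2) B^g A^(-g/2) is similar to the contraction
    A^(-s/2) B^g A^(-s'/2), so that its spectrum does not exceed 1.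

    All of this needs the functional calculus for real powers, which is built on
    two facts. A self-adjoint T is bounded above by every real c such that no
    l > c lies in its spectrum [le_of_invertible]; with the factorization of
    complex polynomials this gives |p(T)| <= sup |p| over the spectrum, hence
    uniqueness of f(T). Existence follows by completeness from a uniform
    polynomial approximation of x^s on a compact interval of positive numbers,
    obtained from Bernstein polynomials of Lipschitz functions. *)

Set Implicit Arguments.
Unset Strict Implicit.
Unset Printing Implicit Defensive.

Import Order.TTheory GRing.Theory Num.Theory numFieldNormedType.Exports.

Local Open Scope classical_set_scope.
Local Open Scope ring_scope.

(** * The real inner product *)

Section RealStructure.
Variables (R : realType) (H : hilbertSpace R).
Implicit Types (x y z : H) (c : R) (T X Y Z : operator H).

Definition rinner x y : R := complex.Re (inner x y).
Definition rnorm x : R := complex.Re `|x|.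

Lemma ReD (a b : R[i]) : complex.Re (a + b) = complex.Re a + complex.Re b.
Proof. by case: a b => [a ?] [b ?]. Qed.

Lemma ReN (a : R[i]) : complex.Re (- a) = - complex.Re a.
Proof. by case: a. Qed.

Lemma opZ T (a : R[i]) x : T (a *: x) = a *: T x.
Proof. exact: linearZ_LR. Qed.

Lemma rnormE x : `|x| = (rnorm x)%:C%C.
Proof.
by rewrite /rnorm RRe_real // ger0_real.
Qed.

Lemma rnorm_ge0 x : 0 <= rnorm x.
Proof. by rewrite -ler0c -rnormE. Qed.

Lemma rinnerxx x : rinner x x = rnorm x ^+ 2.
Proof. by rewrite /rinner innerE rnormE -rmorphXn. Qed.

Lemma rnorm0 : rnorm 0 = 0.
Proof. by rewrite /rnorm normr0. Qed.

Lemma rnorm_le0 x : rnorm x <= 0 -> x = 0.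
Proof.
move=> x0; apply/eqP; rewrite -normr_eq0 rnormE.
by have /eqP -> : rnorm x == 0 by rewrite eq_le x0 rnorm_ge0.
Qed.

Lemma rnormD x y : rnorm (x + y) <= rnorm x + rnorm y.
Proof. by rewrite -lecR rmorphD /= -!rnormE ler_normD. Qed.

Lemma rnormN x : rnorm (- x) = rnorm x.
Proof. by rewrite /rnorm normrN. Qed.

Lemma rnormZ c x : rnorm (c%:C%C *: x) = `|c| * rnorm x.
Proof.
rewrite {1}/rnorm normrZ rnormE normc_def /= expr0n /= addr0 sqrtr_sqr.
by rewrite mul0r subr0.
Qed.

Lemma innerC x y : inner x y = (inner y x)^*%C.
Proof.
by rewrite (@hermC _ false Num.conj H inner x y) expr0 mul1r.
Qed.

Lemma rinnerC x y : rinner x y = rinner y x.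
Proof. by rewrite /rinner innerC; case: (inner y x). Qed.

Lemma innerDl x y z : inner (x + y) z = inner x z + inner y z.
Proof. exact: linearDl. Qed.

Lemma innerDr x y z : inner z (x + y) = inner z x + inner z y.
Proof. exact: linearDr. Qed.

Lemma innerNl x z : inner (- x) z = - inner x z.
Proof. exact: linearNl. Qed.

Lemma innerNr x z : inner z (- x) = - inner z x.
Proof. exact: linearNr. Qed.

Lemma rinnerDl x y z : rinner (x + y) z = rinner x z + rinner y z.
Proof. by rewrite /rinner innerDl ReD. Qed.

Lemma rinnerDr x y z : rinner z (x + y) = rinner z x + rinner z y.
Proof. by rewrite rinnerC rinnerDl !(rinnerC _ z). Qed.

Lemma rinnerNl x z : rinner (- x) z = - rinner x z.
Proof. by rewrite /rinner innerNl ReN. Qed.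

Lemma rinnerNr x z : rinner z (- x) = - rinner z x.
Proof. by rewrite rinnerC rinnerNl rinnerC. Qed.

Lemma rinnerBl x y z : rinner (x - y) z = rinner x z - rinner y z.
Proof. by rewrite rinnerDl rinnerNl. Qed.

Lemma innerZl (a : R[i]) x z : inner (a *: x) z = a * inner x z.
Proof. by rewrite linearZl_LR. Qed.

Lemma innerZr (a : R[i]) x z : inner z (a *: x) = a^*%C * inner z x.
Proof. by rewrite innerC innerZl rmorphM /= -innerC. Qed.

Lemma rinnerZl c x z : rinner (c%:C%C *: x) z = c * rinner x z.
Proof.
by rewrite /rinner innerZl; case: (inner x z) => a b /=; rewrite mul0r subr0.
Qed.

Lemma rinnerZr c x z : rinner z (c%:C%C *: x) = c * rinner z x.
Proof. by rewrite rinnerC rinnerZl rinnerC. Qed.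

Lemma rinner0l x : rinner 0 x = 0.
Proof. by rewrite -[0](subrr (0 : H)) rinnerBl subrr. Qed.

(** Expand the square of the norm of [x - c y]. This weighted arithmetic-geometric
    inequality replaces Cauchy-Schwarz throughout. *)
Lemma rinner_le x y c : 0 < c ->
  2 * rinner x y <= c^-1 * rnorm x ^+ 2 + c * rnorm y ^+ 2.
Proof.
move=> c0.
have /= : 0 <= rnorm (x - c%:C%C *: y) ^+ 2 by rewrite exprn_ge0 ?rnorm_ge0.
rewrite -!rinnerxx rinnerBl !rinnerDr !rinnerNr !rinnerZl !rinnerZr.
rewrite (rinnerC y x) => h.
have ci : 0 < c^-1 by rewrite invr_gt0.
have : 0 <= c^-1 * (rinner x x - c * rinner x y
    - c * (rinner x y - c * rinner y y)).
  rewrite mulr_ge0 ?(ltW ci) //; lra.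
have -> : c^-1 * (rinner x x - c * rinner x y
    - c * (rinner x y - c * rinner y y)) =
  c^-1 * rinner x x - 2 * rinner x y + c * rinner y y.
  by field; rewrite gt_eqF.
lra.
Qed.

(** The imaginary part of [inner x y] is recovered by replacing [x] with [i x],
    so the real inner product sees self-adjointness. *)
Lemma selfadjointP T :
  selfadjoint T <-> forall x y, rinner (T x) y = rinner x (T y).
Proof.
split=> [sT x y|sT x y]; first by rewrite /rinner sT.
have h := sT x y; have := sT ('i%C *: x) y.
move: h; rewrite opZ /rinner !innerZl.
case: (inner (T x) y) => a b; case: (inner x (T y)) => c d /=.
by rewrite !mul0r !mul1r !sub0r => -> /eqP; rewrite eqr_opp => /eqP ->.
Qed.

(** Polarization: the sesquilinear form [<Tx, y> - <x, Ty>] vanishes on the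
    diagonal, and over the complex numbers it then vanishes everywhere. *)
Lemma positive_selfadjoint T : positive T -> selfadjoint T.
Proof.
move=> pT.
pose B x y := inner (T x) y - inner x (T y).
have Bxx x : B x x = 0.
  apply/eqP; rewrite /B (innerC x) subr_eq0; apply/eqP.
  by rewrite -[RHS]/(Num.conj _) conj_Creal // ger0_real // pT.
have BDl x y z : B (x + y) z = B x z + B y z.
  by rewrite /B (linearD T) !innerDl opprD addrACA.
have BDr x y z : B z (x + y) = B z x + B z y.
  by rewrite /B (linearD T) !innerDr opprD addrACA.
have h x y : B x y + B y x = 0.
  by have := Bxx (x + y); rewrite BDl !BDr !Bxx add0r addr0.
have k x y : B y x = B x y.
  have := h x ('i%C *: y).
  rewrite /B opZ !innerZr !innerZl -!mulrBr.
  have -> : ('i%C : R[i])^*%C = - 'i%C by apply/eqP; rewrite eq_complex /= oppr0 !eqxx.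
  rewrite mulNr addrC => /eqP; rewrite subr_eq0 => /eqP /(mulfI _) -> //.
  by rewrite eq_complex /= oner_eq0 andbF.
move=> x y; apply/eqP; rewrite -subr_eq0; apply/eqP.
have /eqP := h x y; rewrite (k x y) -mulr2n mulrn_eq0 /=.
by move/eqP.
Qed.

Lemma inner_selfadjoint T x : selfadjoint T -> inner (T x) x = (rinner (T x) x)%:C%C.
Proof.
move=> sT; rewrite /rinner RRe_real //.
by apply/CrealP; rewrite -[LHS]/((_)^*%C) -innerC sT.
Qed.

Lemma positiveP T :
  positive T <-> selfadjoint T /\ forall x, 0 <= rinner (T x) x.
Proof.
split=> [pT|[sT pT] x]; last by rewrite inner_selfadjoint // ler0c.
have sT := positive_selfadjoint pT; split=> // x.
by rewrite -ler0c -inner_selfadjoint.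
Qed.

End RealStructure.

(** * Order and norm bounds of self-adjoint operators *)

Section OperatorOrder.
Variables (R : realType) (H : hilbertSpace R).
Implicit Types (x y z : H) (c d : R) (T X Y Z C : operator H).

Definition scalar_op c : operator H := c%:C%C *: (1 : operator H).

Lemma opDE X Y x : (X + Y) x = X x + Y x. Proof. by []. Qed.
Lemma opNE X x : (- X) x = - X x. Proof. by []. Qed.
Lemma opBE X Y x : (X - Y) x = X x - Y x. Proof. by []. Qed.
Lemma opME X Y x : (X * Y) x = X (Y x). Proof. by []. Qed.
Lemma op1E x : (1 : operator H) x = x. Proof. by []. Qed.
Lemma op0E x : (0 : operator H) x = 0. Proof. by []. Qed.
Lemma opZE (a : R[i]) X x : (a *: X) x = a *: X x. Proof. by []. Qed.
Lemma scalar_opE c x : scalar_op c x = c%:C%C *: x. Proof. by []. Qed.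
Definition opE := (opDE, opNE, opME, scalar_opE, opZE, op1E, op0E).

Lemma opD X x y : X (x + y) = X x + X y. Proof. exact: raddfD. Qed.
Lemma opN X x : X (- x) = - X x. Proof. exact: raddfN. Qed.
Lemma op_0 X : X 0 = 0. Proof. exact: raddf0. Qed.

Lemma scalar_op1 : scalar_op 1 = 1.
Proof. by rewrite /scalar_op scale1r. Qed.
Lemma scalar_op0 : scalar_op 0 = 0.
Proof. by rewrite /scalar_op scale0r. Qed.
Lemma scalar_opD c d : scalar_op (c + d) = scalar_op c + scalar_op d.
Proof. by rewrite /scalar_op rmorphD scalerDl. Qed.
Lemma scalar_opN c : scalar_op (- c) = - scalar_op c.
Proof. by rewrite /scalar_op rmorphN scaleNr. Qed.
Lemma scalar_opC c X : scalar_op c * X = X * scalar_op c.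
Proof. by apply: operatorP => x; rewrite !opE opZ. Qed.

Lemma scaler_opAl (a : R[i]) X Y : a *: (X * Y) = a *: X * Y.
Proof. by apply: operatorP => x; rewrite !opE. Qed.
Lemma scaler_opAr (a : R[i]) X Y : a *: (X * Y) = X * (a *: Y).
Proof. by apply: operatorP => x; rewrite !opE opZ. Qed.

Lemma selfadjointD X Y : selfadjoint X -> selfadjoint Y -> selfadjoint (X + Y).
Proof. by move=> sX sY x y; rewrite !opE innerDl sX sY -innerDr. Qed.
Lemma selfadjointN X : selfadjoint X -> selfadjoint (- X).
Proof. by move=> sX x y; rewrite !opE innerNl sX -innerNr. Qed.
Lemma selfadjointB X Y : selfadjoint X -> selfadjoint Y -> selfadjoint (X - Y).
Proof. by move=> sX sY; apply: selfadjointD => //; apply: selfadjointN. Qed.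
Lemma selfadjointZ c X : selfadjoint X -> selfadjoint (c%:C%C *: X).
Proof. by move=> sX x y; rewrite !opE innerZl innerZr sX conjc_real. Qed.
Lemma selfadjoint0 : selfadjoint (0 : operator H).
Proof. by move=> x y; rewrite !opE (linear0l inner) (linear0r inner). Qed.
Lemma selfadjoint1 : selfadjoint (1 : operator H).
Proof. by []. Qed.
Lemma selfadjoint_scalar c : selfadjoint (scalar_op c).
Proof. exact: selfadjointZ selfadjoint1. Qed.
Lemma selfadjoint_comm X Y : selfadjoint X -> selfadjoint Y ->
  X * Y = Y * X -> selfadjoint (X * Y).
Proof. by move=> sX sY XY x y; rewrite [in RHS]XY !opE sX sY. Qed.
Lemma selfadjoint_conj C X : selfadjoint C -> selfadjoint X ->
  selfadjoint (C * X * C).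
Proof. by move=> sC sX x y; rewrite !opE !(sC, sX). Qed.
Lemma operator_geP X Y : X >=% Y <->
  [/\ selfadjoint X, selfadjoint Y &
      forall x, rinner (Y x) x <= rinner (X x) x].
Proof.
split=> -[sX sY h]; split=> //.
  by move=> x; have /positiveP[_ /(_ x)] := h; rewrite opBE rinnerBl subr_ge0.
apply/positiveP; split=> [|x]; first exact: selfadjointB.
by rewrite opBE rinnerBl subr_ge0.
Qed.

Lemma operator_ge_rinner X Y x : X >=% Y -> rinner (Y x) x <= rinner (X x) x.
Proof. by move=> /operator_geP[]. Qed.

Lemma operator_ge_refl X : selfadjoint X -> X >=% X.
Proof. by move=> sX; apply/operator_geP; split. Qed.

Lemma operator_ge_trans Y X Z : X >=% Y -> Y >=% Z -> X >=% Z.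
Proof.
move=> /operator_geP[sX sY h] /operator_geP[_ sZ k].
by apply/operator_geP; split=> // x; apply: le_trans (k x) (h x).
Qed.

Lemma operator_geD X Y X' Y' : X >=% Y -> X' >=% Y' -> (X + X') >=% (Y + Y').
Proof.
move=> /operator_geP[sX sY h] /operator_geP[sX' sY' k].
apply/operator_geP; split; try exact: selfadjointD.
by move=> x; rewrite !opE !rinnerDl lerD.
Qed.

Lemma operator_ge_opp X Y : X >=% Y -> (- Y) >=% (- X).
Proof.
move=> /operator_geP[sX sY h].
apply/operator_geP; split; try exact: selfadjointN.
by move=> x; rewrite !opE !rinnerNl lerN2.
Qed.

Lemma operator_ge_sub0 X Y : selfadjoint X -> selfadjoint Y ->
  (X - Y) >=% 0 <-> X >=% Y.
Proof.
move=> sX sY; split=> /operator_geP[_ _ h]; apply/operator_geP; split=> //.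
- by move=> x; have := h x; rewrite !opE rinnerBl rinner0l subr_ge0.
- exact: selfadjointB.
- exact: selfadjoint0.
- by move=> x; have := h x; rewrite !opE rinnerBl rinner0l subr_ge0.
Qed.

Lemma positive_ge0 X : positive X <-> X >=% 0.
Proof.
rewrite positiveP; split=> [[sX h]|/operator_geP[sX _ h]].
  apply/operator_geP; split=> //; first exact: selfadjoint0.
  by move=> x; rewrite op0E rinner0l.
by split=> // x; have := h x; rewrite op0E rinner0l.
Qed.

Lemma operator_ge_conj C X Y : selfadjoint C -> X >=% Y ->
  (C * X * C) >=% (C * Y * C).
Proof.
move=> sC /operator_geP[sX sY h].
apply/operator_geP; split; try exact: selfadjoint_conj.
by move=> x; rewrite !opE !(selfadjointP C).1.
Qed.

Lemma operator_ge_scalar c d : d <= c -> scalar_op c >=% scalar_op d.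
Proof.
move=> dc; apply/operator_geP; split; try exact: selfadjoint_scalar.
by move=> x; rewrite !opE !rinnerZl ler_wpM2r // rinnerxx exprn_ge0 ?rnorm_ge0.
Qed.

Lemma operator_geE X Y : X >=% Y -> selfadjoint X /\ selfadjoint Y.
Proof. by case. Qed.

Definition bounded_by T c := forall x, rnorm (T x) <= c * rnorm x.

Lemma bounded_byP T : exists2 c : R, 0 < c & bounded_by T c.
Proof.
have [M M0 TM] := operator_bounded_ge0 T.
have := TM; move: M0; rewrite lecE /= => /andP[/eqP iM rM] _.
exists (complex.Re M + 1); first by rewrite ltr_wpDl.
move=> x; have := TM x; rewrite !rnormE.
have -> : M = (complex.Re M)%:C%C by case: (M) iM => a b /= ->.
rewrite -rmorphM lecR => /le_trans; apply.
by rewrite /= ler_wpM2r ?rnorm_ge0 // lerDl.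
Qed.

(** Replaces the supremum by pointwise bounds, which are stable under sums,
    products and limits. *)
Lemma operator_normP T c : 0 <= c -> operator_norm T <= c <-> bounded_by T c.
Proof.
move=> c0.
pose A : set R := [set complex.Re `|T x| | x in [set x : H | `|x| <= 1]].
have A0 : A 0 by exists 0 => /=; rewrite ?normr0 ?op_0 ?normr0 ?ler01.
split=> h.
  move=> x; have [->|x0] := eqVneq x 0; first by rewrite op_0 !rnorm0 mulr0.
  have nx : 0 < rnorm x.
    rewrite lt_neqAle rnorm_ge0 andbT eq_sym; apply: contra x0 => /eqP h0.
    by apply/eqP/rnorm_le0; rewrite h0.
  rewrite -ler_pdivrMr //; apply: le_trans h.
  apply: sup_upper_bound.
    split; first by exists 0.
    have [d d0 Td] := bounded_byP T; exists d => _ [y /= y1 <-].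
    rewrite -/(rnorm _); apply: le_trans (Td _) _.
    by rewrite ger_pMr // -lecR -rnormE.
  exists ((rnorm x)^-1%:C%C *: x) => /=.
    by rewrite rnormE rnormZ ger0_norm ?invr_ge0 ?rnorm_ge0 // mulVf ?gt_eqF.
  by rewrite opZ -/(rnorm _) rnormZ ger0_norm ?invr_ge0 ?rnorm_ge0 // mulrC.
apply: ge_sup; first by exists 0.
move=> _ [x /= x1 <-]; rewrite -/(rnorm _); apply: le_trans (h _) _.
by rewrite ler_piMr // -lecR -rnormE.
Qed.

Lemma bounded_byD X Y c d : bounded_by X c -> bounded_by Y d ->
  bounded_by (X + Y) (c + d).
Proof.
by move=> hX hY x; rewrite opE (le_trans (rnormD _ _)) // mulrDl lerD.
Qed.
Lemma bounded_byN X c : bounded_by X c -> bounded_by (- X) c.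
Proof. by move=> hX x; rewrite opE rnormN. Qed.
Lemma bounded_byB X Y c d : bounded_by X c -> bounded_by Y d ->
  bounded_by (X - Y) (c + d).
Proof. by move=> hX hY; apply: bounded_byD => //; apply: bounded_byN. Qed.
Lemma bounded_byBC X Y c : bounded_by (X - Y) c -> bounded_by (Y - X) c.
Proof. by move=> /bounded_byN; rewrite opprB. Qed.
Lemma bounded_byM X Y c d : 0 <= c -> bounded_by X c -> bounded_by Y d ->
  bounded_by (X * Y) (c * d).
Proof.
move=> c0 hX hY x; rewrite opE (le_trans (hX _)) // -mulrA.
by rewrite ler_wpM2l.
Qed.
Lemma bounded_byW X c d : c <= d -> bounded_by X c -> bounded_by X d.
Proof.
by move=> cd hX x; apply: le_trans (hX x) _; rewrite ler_wpM2r ?rnorm_ge0.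
Qed.
Lemma bounded_by_eq0 X : (forall e, 0 < e -> bounded_by X e) -> X = 0.
Proof.
move=> h; apply: operatorP => x; rewrite opE; apply: rnorm_le0.
apply/ler_addgt0Pl => e e0; rewrite addr0.
have n0 : 0 < rnorm x + 1 by rewrite ltr_wpDl // rnorm_ge0.
apply: le_trans (h (e / (rnorm x + 1)) _ x) _; first by rewrite divr_gt0.
rewrite -mulrA ger_pMr // ler_pdivrMl // mulr1 lerDl.
exact: ler01.
Qed.

Lemma bounded_by_ge X c : 0 < c -> selfadjoint X -> bounded_by X c ->
  scalar_op c >=% X /\ X >=% scalar_op (- c).
Proof.
move=> c0 sX hX.
have k x (e : R) : `|e| = 1 -> rinner (X (e%:C%C *: x)) x <= c * rnorm x ^+ 2.
  move=> e1; have := @rinner_le _ _ (X (e%:C%C *: x)) x c c0.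
  have : rnorm (X (e%:C%C *: x)) ^+ 2 <= c ^+ 2 * rnorm x ^+ 2.
    rewrite -exprMn ler_sqr ?nnegrE ?rnorm_ge0 ?mulr_ge0 ?rnorm_ge0 ?(ltW c0) //.
    by apply: le_trans (hX _) _; rewrite rnormZ e1 mul1r.
  move=> /(ler_wpM2l (ltW (_ : 0 < c^-1))); rewrite invr_gt0 => /(_ c0).
  rewrite expr2 !mulrA mulVf ?gt_eqF // mul1r; lra.
split; apply/operator_geP; split=> //; try exact: selfadjoint_scalar.
  by move=> x; have := k x 1 (normr1 _); rewrite scale1r opE rinnerZl rinnerxx.
move=> x; have := k x (-1); rewrite normrN1 opE rinnerZl rinnerxx rmorphN.
by rewrite scaleN1r opN rinnerNl => /(_ erefl); lra.
Qed.

(** Write [P = c - X] and [Q = c + X]. These are positive, commute, and add up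
    to [2c], so [2c PQ = PQP + QPQ] is positive; but [PQ = c^2 - X^2]. *)
Lemma bounded_by_selfadjoint X c : 0 < c ->
  scalar_op c >=% X -> X >=% scalar_op (- c) -> bounded_by X c.
Proof.
move=> c0 hu hl x.
have [_ sX] := operator_geE hu.
pose P := scalar_op c - X; pose Q := scalar_op c + X.
have sP : selfadjoint P by apply: selfadjointB => //; exact: selfadjoint_scalar.
have sQ : selfadjoint Q by apply: selfadjointD => //; exact: selfadjoint_scalar.
have P0 y : 0 <= rinner (P y) y.
  by rewrite opBE rinnerBl subr_ge0; exact: operator_ge_rinner.
have Q0 y : 0 <= rinner (Q y) y.
  rewrite opDE rinnerDl -[rinner (scalar_op c y) y]opprK addrC subr_ge0.
  by rewrite -rinnerNl -opNE -scalar_opN; exact: operator_ge_rinner.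
have PQ2c : P + Q = scalar_op (c + c).
  by rewrite /P /Q addrACA addNr addr0 scalar_opD.
have PQ : P * Q = Q * P.
  have -> : Q = scalar_op (c + c) - P by rewrite -PQ2c addrAC subrr add0r.
  by rewrite mulrBr [RHS]mulrBl scalar_opC.
have PQ0 : 0 <= (c + c) * rinner ((P * Q) x) x.
  have -> : (c + c) * rinner ((P * Q) x) x =
      rinner (Q (P x)) (P x) + rinner (P (Q x)) (Q x).
    rewrite -rinnerZl -scalar_opE -opME -PQ2c mulrDl {1}PQ opDE rinnerDl !opME.
    by rewrite [rinner (P _) x](selfadjointP P).1 // [rinner (Q (P (Q x))) x](selfadjointP Q).1.
  exact: addr_ge0.
have c2 : 0 < c + c by rewrite addr_gt0.
move: PQ0; rewrite pmulr_rge0 //.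
have -> : rinner ((P * Q) x) x = c ^+ 2 * rnorm x ^+ 2 - rnorm (X x) ^+ 2.
  rewrite opME /P /Q opBE !opDE !scalar_opE opD opZ rinnerBl !rinnerZl.
  rewrite !rinnerDl !rinnerZl [rinner (X (X x)) _](selfadjointP X).1 //.
  by rewrite !rinnerxx; ring.
rewrite subr_ge0 -exprMn ler_sqr ?nnegrE ?mulr_ge0 ?rnorm_ge0 //.
exact: ltW.
Qed.

End OperatorOrder.

(** * Completeness and the Neumann series *)

Section Completeness.
Variables (R : realType) (H : hilbertSpace R).
Implicit Types (x y z : H) (c d : R) (T X Y Z C : operator H).

(** The modulus [e] bounds the distance from each term to all later ones, and
    this bound passes to the limit. *)
Lemma hilbert_complete (u : nat -> H) (e : nat -> R) :
  (forall d, 0 < d -> exists k, e k < d) ->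
  (forall k l, (k <= l)%N -> rnorm (u k - u l) <= e k) ->
  exists y, forall k, rnorm (u k - y) <= e k.
Proof.
move=> e0 ue.
have : cvg (u @ \oo).
  apply/cauchy_cvgP/cauchy_exP => d d0.
  have dE : d = (complex.Re d)%:C%C by rewrite RRe_real // gtr0_real.
  have [|k ek] := e0 (complex.Re d); first by rewrite -ltcR -dE.
  exists (u k); exists k => //= n /= kn.
  rewrite -ball_normE /= rnormE dE ltcR.
  exact: le_lt_trans (ue _ _ kn) ek.
move=> /cvg_ex[/= y /cvgrPdist_lt uy]; exists y => k.
apply/ler_addgt0Pr => d d0.
have [|N _ hN] := uy d%:C%C; first by rewrite ltcR.
have := hN (maxn N k) (leq_maxl _ _).
rewrite /= rnormE ltcR -rnormN opprB => h.
have -> : u k - y = (u k - u (maxn N k)) + (u (maxn N k) - y).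
  by rewrite addrA subrK.
apply: le_trans (rnormD _ _) _; apply: lerD; last exact: ltW.
by apply: ue; exact: leq_maxr.
Qed.

(** The pointwise limit is linear, and it inherits the modulus uniformly on
    bounded sets, which is convergence in operator norm. *)
Lemma operator_complete (T : nat -> operator H) (e : nat -> R) :
  (forall d, 0 < d -> exists k, e k < d) ->
  (forall k l, (k <= l)%N -> bounded_by (T k - T l) (e k)) ->
  exists X, forall k, bounded_by (T k - X) (e k).
Proof.
move=> e0 Te.
have hx x : exists y, forall k, rnorm (T k x - y) <= e k * rnorm x.
  apply: hilbert_complete => [d d0|k l kl]; last exact: Te.
  have n0 : 0 < rnorm x + 1 by rewrite ltr_wpDl // rnorm_ge0.
  have ek_ge0 k : 0 < rnorm x -> 0 <= e k.
    move=> x0; have := Te k k (leqnn k) x.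
    by rewrite subrr op0E rnorm0 pmulr_lge0.
  have [|k ek] := e0 (d / (rnorm x + 1)); first by rewrite divr_gt0.
  exists k; have := rnorm_ge0 x; rewrite le_eqVlt => /orP[/eqP <-|x0].
    by rewrite mulr0.
  apply: le_lt_trans (_ : e k * (rnorm x + 1) < _).
    by rewrite ler_wpM2l ?ek_ge0 // lerDl.
  by rewrite -ltr_pdivlMr.
have [f fP] := choice hx.
have small y d0 : 0 <= d0 -> (forall k, rnorm y <= e k * d0) -> y = 0.
  move=> d00 h; apply: rnorm_le0; apply/ler_addgt0Pr => d d1; rewrite add0r.
  have n0 : 0 < d0 + 1 by rewrite ltr_wpDl.
  have [|k ek] := e0 (d / (d0 + 1)); first by rewrite divr_gt0.
  apply: le_trans (h k) _.
  apply: le_trans (ler_wpM2r d00 (ltW ek)) _.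
  by rewrite -mulrA ger_pMr // ler_pdivrMl // mulr1 lerDl.
have flin : linear f.
  move=> a x y; apply/eqP; rewrite -subr_eq0; apply/eqP.
  have [na na0 naE] : exists2 na : R, 0 <= na & forall z, rnorm (a *: z) = na * rnorm z.
    have aE : `|a| = (complex.Re `|a|)%:C%C by rewrite RRe_real // ger0_real.
    exists (complex.Re `|a|) => [|z]; first by rewrite -ler0c -aE.
    by rewrite {1}/rnorm normrZ aE rnormE -rmorphM.
  apply: (small _ (rnorm (a *: x + y) + na * rnorm x + rnorm y)).
    by rewrite !addr_ge0 ?mulr_ge0 ?rnorm_ge0.
  move=> k.
  have -> : f (a *: x + y) - (a *: f x + f y) =
    - (T k (a *: x + y) - f (a *: x + y)) + (a *: (T k x - f x) + (T k y - f y)).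
    rewrite opD opZ scalerBr opprB (addrACA (a *: T k x)) -opprD.
    by rewrite addrA subrK.
  apply: le_trans (rnormD _ _) _; rewrite rnormN -addrA mulrDr lerD //.
  apply: le_trans (rnormD _ _) _; rewrite mulrDr lerD //.
  by rewrite naE mulrCA ler_wpM2l.
have fbd : exists M : R[i], forall x, `|f x| <= M * `|x|.
  have [c c0 Tc] := bounded_byP (T 0%N).
  exists (c + e 0%N)%:C%C => x; rewrite !rnormE -rmorphM lecR.
  have -> : f x = T 0%N x + - (T 0%N x - f x) by rewrite opprB addrC subrK.
  apply: le_trans (rnormD _ _) _; rewrite rnormN mulrDl; apply: lerD => //.
exists (Operator flin fbd) => k x.
by rewrite opBE /=.
Qed.

(** The partial sums of the geometric series converge in norm, and their limit
    is a two-sided inverse because [S n (1 - X) = 1 - X^n]. *)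
Lemma neumann X c : 0 <= c < 1 -> bounded_by X c -> invertible (1 - X).
Proof.
move=> /andP[c0 c1] Xc.
pose S n := \sum_(i < n) X ^+ i.
have SX n : S n * (1 - X) = 1 - X ^+ n.
  elim: n => [|n IH]; first by rewrite /S big_ord0 mul0r expr0 subrr.
  rewrite /S big_ord_recr /= mulrDl -/(S n) IH mulrBr mulr1 -exprSr.
  by rewrite addrA subrK.
have XS n : (1 - X) * S n = 1 - X ^+ n.
  elim: n => [|n IH]; first by rewrite /S big_ord0 mulr0 expr0 subrr.
  rewrite /S big_ord_recr /= mulrDr -/(S n) IH mulrBl mul1r -exprS.
  by rewrite addrA subrK.
have Xn n : bounded_by (X ^+ n) (c ^+ n).
  elim: n => [x|n IH]; first by rewrite !expr0 op1E mul1r.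
  by rewrite !exprS; exact: bounded_byM.
have cn n : 0 <= c ^+ n by exact: exprn_ge0.
have c10 : 0 < 1 - c by rewrite subr_gt0.
have Sl n m : bounded_by (S (n + m)%N - S n) ((c ^+ n - c ^+ (n + m)) / (1 - c)).
  elim: m => [|m IH].
    by rewrite addn0 !subrr mul0r => x; rewrite op0E rnorm0 mul0r.
  rewrite addnS /S big_ord_recr /= -/(S _) addrAC.
  have -> : (c ^+ n - c ^+ (n + m).+1) / (1 - c) =
    (c ^+ n - c ^+ (n + m)) / (1 - c) + c ^+ (n + m).
    by rewrite exprS; field; rewrite gt_eqF.
  exact: bounded_byD.
have c0lim d : 0 < d -> exists k, c ^+ k / (1 - c) < d.
  move=> d0; have : (c ^+ n @[n --> \oo] --> 0) by apply: cvg_expr; rewrite ger0_norm.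
  move=> /cvgrPdist_lt /(_ (d * (1 - c)) (mulr_gt0 d0 c10)) [N _ hN].
  exists N; rewrite ltr_pdivrMr //.
  by have := hN N (leqnn N); rewrite /= sub0r normrN ger0_norm.
have [k l kl|Y hY] := @operator_complete S (fun n => c ^+ n / (1 - c)) c0lim.
  apply: bounded_byBC; rewrite -(subnKC kl); apply: bounded_byW (Sl _ _).
  by rewrite ler_wpM2r ?invr_ge0 ?(ltW c10) // gerBl.
have [d d0 hd] := bounded_byP (1 - X).
have small e Z : 0 < e ->
    (forall k, bounded_by Z (c ^+ k / (1 - c) * d + c ^+ k)) -> bounded_by Z e.
  move=> e0 hZ; have [|k hk] := c0lim (e / (d + 1)).
    by rewrite divr_gt0 // addr_gt0.
  apply: bounded_byW (hZ k).
  apply: le_trans (_ : c ^+ k / (1 - c) * (d + 1) <= _).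
    rewrite mulrDr mulr1 lerD2l ler_peMr // invf_ge1 // gerBl //.
  by rewrite -ler_pdivlMr ?addr_gt0 // ltW.
have ek k : 0 <= c ^+ k / (1 - c) by rewrite divr_ge0 // ltW.
exists Y; split; apply/eqP; rewrite -subr_eq0; apply/eqP; apply: bounded_by_eq0 => e e0;
  apply: small => // k.
  have -> : Y * (1 - X) - 1 = - ((S k - Y) * (1 - X)) - X ^+ k.
    by rewrite mulrBl SX !opprB addrA addrAC addrK.
  by apply: bounded_byB => //; apply: bounded_byN; apply: bounded_byM.
have -> : (1 - X) * Y - 1 = - ((1 - X) * (S k - Y)) - X ^+ k.
  by rewrite mulrBr XS !opprB addrA addrAC addrK.
apply: bounded_byB => //; apply: bounded_byN; rewrite mulrC.
by apply: bounded_byM => //; exact: ltW.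
Qed.

End Completeness.

(** * Invertibility and the top of the spectrum *)

Section Spectrum.
Variables (R : realType) (H : hilbertSpace R).
Implicit Types (x y z : H) (c d : R) (T X Y Z C U : operator H).

Lemma is_inverse_uniq X U Y : is_inverse X U -> is_inverse X Y -> U = Y.
Proof.
by move=> [UX _] [_ XY]; rewrite -[U]mulr1 -XY mulrA UX mul1r.
Qed.

Lemma invertible1 : invertible (1 : operator H).
Proof. by exists 1; split; rewrite mulr1. Qed.

Lemma invertibleM X Y : invertible X -> invertible Y -> invertible (X * Y).
Proof.
move=> [U [UX XU]] [W [WY YW]]; exists (W * U); split.
  by rewrite mulrA -(mulrA W) UX mulr1.
by rewrite mulrA -(mulrA X) YW mulr1.
Qed.

Lemma invertible_comm X Y : X * Y = Y * X -> invertible (X * Y) -> invertible X.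
Proof.
move=> XY [U [UXY XYU]].
have YXY : Y * (X * Y) = X * Y * Y by rewrite mulrA -XY.
have e : U * Y = Y * U.
  by rewrite -[LHS]mulr1 -XYU mulrA -(mulrA U) YXY (mulrA U) UXY mul1r.
exists (Y * U); split; last by rewrite mulrA.
by rewrite -e -mulrA -XY.
Qed.

Lemma invertibleZ (a : R[i]) X : a != 0 -> invertible X -> invertible (a *: X).
Proof.
move=> a0 [U [UX XU]]; exists (a^-1 *: U).
by split; rewrite -scaler_opAl -scaler_opAr scalerA ?mulVf ?mulfV // ?UX ?XU scale1r.
Qed.

(** Once [X] is divided by a number exceeding its norm, it differs from the
    identity by an operator of norm less than one. *)
Lemma invertible_ge X c : 0 < c -> X >=% scalar_op H c -> invertible X.
Proof.
move=> c0 hX; have [sX _] := operator_geE hX.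
have [M M0 XM] := bounded_byP X.
have [XuM _] := bounded_by_ge M0 sX XM.
(* adding c to M makes c / N less than 1 *)
pose N := M + c.
have N0 : 0 < N by rewrite addr_gt0.
have cN : c < N by rewrite ltrDr.
pose k := 1 - c / N.
have k1 : 0 < k < 1.
  by rewrite subr_gt0 ltr_pdivrMr // mul1r cN /= gtrBl divr_gt0.
pose K := 1 - (N^-1)%:C%C *: X.
have sK : selfadjoint K.
  by apply: selfadjointB; [exact: selfadjoint1|exact: selfadjointZ].
have KE x : rinner (K x) x = rnorm x ^+ 2 - N^-1 * rinner (X x) x.
  by rewrite /K !opE rinnerBl rinnerZl rinnerxx.
have Ni : 0 <= N^-1 by rewrite invr_ge0 ltW.
have hK : bounded_by K k.
  case/andP: k1 => k0 k1.
  apply: bounded_by_selfadjoint => //; apply/operator_geP; split=> //;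
      try exact: selfadjoint_scalar; move=> x; rewrite KE !opE rinnerZl rinnerxx.
    have := operator_ge_rinner x hX; rewrite opE rinnerZl rinnerxx.
    move=> /(ler_wpM2l Ni); rewrite /k mulrA (mulrC _ c); lra.
  have := operator_ge_rinner x XuM; rewrite opE rinnerZl rinnerxx => h.
  have : N^-1 * rinner (X x) x <= rnorm x ^+ 2.
    rewrite ler_pdivrMl //; apply: le_trans h _.
    by rewrite ler_wpM2r ?exprn_ge0 ?rnorm_ge0 // lerDl ltW.
  have : 0 <= k * rnorm x ^+ 2 by rewrite mulr_ge0 ?exprn_ge0 ?rnorm_ge0 // ltW.
  lra.
have := neumann _ hK; case/andP: k1 => /ltW -> -> /(_ isT).
rewrite /K opprB addrC subrK => h.
have -> : X = N%:C%C *: ((N^-1)%:C%C *: X).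
  by rewrite scalerA -rmorphM mulfV ?gt_eqF // scale1r.
apply: invertibleZ => //.
by rewrite eq_complex /= gt_eqF.
Qed.

Lemma operator_geB Z X Y : selfadjoint Z -> X >=% Y -> (X - Z) >=% (Y - Z).
Proof.
move=> sZ XY; apply: (operator_geD XY).
by apply: operator_ge_refl; exact: selfadjointN.
Qed.

(** The operator [X - c/2] has norm at most [c/2]; expand the squared norm of
    its values. *)
Lemma positive_sqr_le X c : 0 < c -> X >=% 0 -> scalar_op H c >=% X ->
  forall x, rnorm (X x) ^+ 2 <= c * rinner (X x) x.
Proof.
move=> c0 X0 Xc x; have [sX _] := operator_geE X0.
have c2 : 0 < c / 2 by rewrite divr_gt0.
have h : bounded_by (X - scalar_op H (c / 2)) (c / 2).
  apply: bounded_by_selfadjoint => //.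
    have {1}-> : scalar_op H (c / 2) = scalar_op H c - scalar_op H (c / 2).
      by rewrite -scalar_opN -scalar_opD; congr scalar_op; lra.
    by apply: operator_geB => //; exact: selfadjoint_scalar.
  have -> : scalar_op H (- (c / 2)) = 0 - scalar_op H (c / 2).
    by rewrite scalar_opN sub0r.
  apply: operator_geB => //.
  exact: selfadjoint_scalar.
have {h} : rnorm ((X - scalar_op H (c / 2)) x) ^+ 2 <= (c / 2 * rnorm x) ^+ 2.
  by rewrite ler_sqr ?h // nnegrE ?rnorm_ge0 // mulr_ge0 ?rnorm_ge0 ?(ltW c2).
rewrite exprMn -!rinnerxx !opE rinnerBl (rinnerC (X x) (_ - _)) (rinnerC (_ *: _) (_ - _)).
rewrite !rinnerBl !rinnerZl !rinnerZr !(rinnerC x (X x)).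
have -> : (c / 2) ^+ 2 = (c / 2) * (c / 2) by rewrite expr2.
move: (rinner (X x) (X x)) (rinner (X x) x) (rinner x x) => p q r; nra.
Qed.

(** If [U] inverts [X >= 0], then [|x| <= |U| |Xx|], while [|Xx|^2 <= M <Xx, x>]
    for an upper bound [M] of [X]. *)
Lemma positive_definite_ge X : positive_definite X <->
  exists2 c, 0 < c & X >=% scalar_op H c.
Proof.
split=> [[/positive_ge0 pX [U [UX XU]]]|[c c0 hX]]; last first.
  split; last exact: invertible_ge hX.
  apply/positive_ge0; apply: operator_ge_trans hX _.
  by rewrite -(scalar_op0 H); apply: operator_ge_scalar; exact: ltW.
have [sX _] := operator_geE pX.
have [M M0 XM] := bounded_byP X; have [d d0 Ud] := bounded_byP U.
have [XuM _] := bounded_by_ge M0 sX XM.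
have dM : 0 < d ^+ 2 * M by rewrite mulr_gt0 // exprn_gt0.
exists (d ^+ 2 * M)^-1; first by rewrite invr_gt0.
apply/operator_geP; split=> //; first exact: selfadjoint_scalar.
move=> x; rewrite opE rinnerZl rinnerxx ler_pdivrMl // -mulrA.
apply: le_trans (_ : d ^+ 2 * rnorm (X x) ^+ 2 <= _); last first.
  by rewrite ler_wpM2l ?exprn_ge0 ?(ltW d0) //; exact: positive_sqr_le.
rewrite -exprMn ler_sqr ?nnegrE ?mulr_ge0 ?rnorm_ge0 ?(ltW d0) //.
by have := Ud (X x); rewrite -opME UX.
Qed.

(** Let [M >= c] be the least upper bound of [T] among the numbers at least [c].
    If [M > c], then [M - T] is positive and invertible, hence at least some
    [d > 0], so that [M - d] is a smaller upper bound. *)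
Lemma le_of_invertible T c : selfadjoint T ->
  (forall l, c < l -> invertible (T - scalar_op H l)) -> scalar_op H c >=% T.
Proof.
move=> sT hT.
have [M M0 TM] := bounded_byP T.
have [TuM _] := bounded_by_ge M0 sT TM.
pose A : set R := [set l | c <= l /\ scalar_op H l >=% T].
have Ainf : has_inf A.
  split; last by exists c => l [].
  exists (Num.max c M); split; first by rewrite le_max lexx.
  by apply: operator_ge_trans TuM; apply: operator_ge_scalar; rewrite le_max lexx orbT.
have cA : c <= inf A by apply: lb_le_inf => [|l []] //; case: Ainf.
have hA : scalar_op H (inf A) >=% T.
  apply/operator_geP; split=> //; first exact: selfadjoint_scalar.
  move=> x; rewrite opE rinnerZl rinnerxx.
  apply/ler_addgt0Pr => e e0.
  have n0 : 0 < rnorm x ^+ 2 + 1 by rewrite ltr_wpDl // exprn_ge0 ?rnorm_ge0.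
  have [|l [_ lT] hl] := @inf_adherent _ A (e / (rnorm x ^+ 2 + 1)) _ Ainf.
    by rewrite divr_gt0.
  have := operator_ge_rinner x lT; rewrite opE rinnerZl rinnerxx => /le_trans; apply.
  apply: le_trans (ler_wpM2r _ (ltW hl)) _; first by rewrite exprn_ge0 ?rnorm_ge0.
  rewrite mulrDl lerD2l -mulrA ger_pMr // ler_pdivrMl // mulr1 lerDl ler01 //.
move: cA; rewrite le_eqVlt => /orP[/eqP -> //|cA].
have : positive_definite (scalar_op H (inf A) - T).
  split.
    by apply/positive_ge0/operator_ge_sub0 => //; exact: selfadjoint_scalar.
  by rewrite -opprB -scaleN1r; apply: invertibleZ; rewrite ?oppr_eq0 ?oner_eq0 //; exact: hT.
move=> /positive_definite_ge[d d0 hd].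
have Ad : A (Num.max c (inf A - d)).
  split; first by rewrite le_max lexx.
  apply: operator_ge_trans (_ : scalar_op H (inf A - d) >=% T).
    by apply: operator_ge_scalar; rewrite le_max lexx orbT.
  apply/operator_geP; split=> //; first exact: selfadjoint_scalar.
  move=> x; have := operator_ge_rinner x hd; rewrite !opE rinnerBl !rinnerZl; lra.
have := ge_inf Ainf.2 Ad.
by rewrite le_max leNgt cA /= leNgt gtrBl d0.
Qed.

(** The product of [T - (a + ib)] and [T - (a - ib)] is [(T - a)^2 + b^2], which
    is at least [b^2]. *)
Lemma spectrum_real T (a b : R) : selfadjoint T -> b != 0 ->
  invertible (T - (a +i* b)%C *: (1 : operator H)).
Proof.
move=> sT b0.
pose V := T - scalar_op H a.
have sV : selfadjoint V by apply: selfadjointB => //; exact: selfadjoint_scalar.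
have e (s : R) : T - (a +i* s)%C *: (1 : operator H) = V - (s%:C%C * 'i%C) *: (1 : operator H).
  rewrite /V /scalar_op -addrA -opprD -scalerDl; congr (_ - _ *: _).
  by apply/eqP; rewrite eq_complex /= !mul0r !mulr0 !subr0 !addr0 mulr1 add0r !eqxx.
have com W (s s' : R[i]) :
    (W - s *: (1 : operator H)) * (W - s' *: (1 : operator H)) =
    W * W - (s + s') *: W + (s * s') *: (1 : operator H).
  rewrite mulrBl !mulrBr -!scaler_opAr -!scaler_opAl !mulr1 !mul1r scalerA.
  rewrite (mulrC s') opprB (addrC ((s * s') *: _)) scalerDl opprD !addrA; congr (_ + _).
  by rewrite addrAC.
apply: (@invertible_comm _ (T - (a -i* b)%C *: (1 : operator H))).
  by rewrite !e !com addrC (addrC (b%:C%C * _)) (mulrC (b%:C%C * _)) addrC.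
rewrite !e com.
have -> : b%:C%C * 'i%C + (- b)%:C%C * 'i%C = 0 :> R[i].
  by rewrite rmorphN mulNr subrr.
have -> : b%:C%C * 'i%C * ((- b)%:C%C * 'i%C) = (b ^+ 2)%:C%C :> R[i].
  apply/eqP; rewrite eq_complex /=; apply/andP; split; apply/eqP; ring.
rewrite scale0r subr0.
apply: (@invertible_ge _ (b ^+ 2)); first by rewrite exprn_even_gt0.
apply/operator_geP; split.
- by apply: selfadjointD; [exact: selfadjoint_comm|exact: selfadjoint_scalar].
- exact: selfadjoint_scalar.
- move=> x; rewrite opDE rinnerDl opME (selfadjointP V).1 // rinnerxx.
  by rewrite lerDr exprn_ge0 ?rnorm_ge0.
Qed.

End Spectrum.

(** * Polynomial approximation of real powers *)

Section Approximation.
Variable R : realType.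
Implicit Types (a b c d e l u v x y : R) (f g : R -> R).

Definition approximable a b f := forall e, 0 < e ->
  exists p : {poly R}, forall l, a <= l <= b -> `|p.[l] - f l| <= e.

Definition lipschitz_on a b f L :=
  forall x y, a <= x <= b -> a <= y <= b -> `|f x - f y| <= L * `|x - y|.

(** Recursive form of the Bernstein polynomials: the value at [x] is the
    expectation of [phi] at a binomial variable of parameters [n] and [x], and
    the recursion conditions on the first trial. *)
Fixpoint bernstein (n : nat) (phi : nat -> R) : {poly R} :=
  if n is n'.+1 then
    (1 - 'X) * bernstein n' phi + 'X * bernstein n' (phi \o succn)
  else (phi 0%N)%:P.

Lemma bernsteinS n phi x : (bernstein n.+1 phi).[x] =
  (1 - x) * (bernstein n phi).[x] + x * (bernstein n (phi \o succn)).[x].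
Proof. by rewrite /= !hornerE. Qed.

Lemma bernstein_le n phi psi x : 0 <= x <= 1 ->
  (forall k, (k <= n)%N -> phi k <= psi k) ->
  (bernstein n phi).[x] <= (bernstein n psi).[x].
Proof.
move=> /andP[x0 x1]; elim: n phi psi => [|n IH] phi psi h.
  by rewrite !hornerC h.
rewrite !bernsteinS lerD // ler_wpM2l ?subr_ge0 //; apply: IH => k kn; apply: h => //.
exact: leqW.
Qed.

(** The variance of the binomial distribution, with [e] as center. *)
Lemma bernstein_quadratic n c d e x :
  (bernstein n (fun k => c + d * (k%:R - e) ^+ 2)).[x] =
  c + d * (n%:R * x * (1 - x) + (n%:R * x - e) ^+ 2).
Proof.
elim: n e => [|n IH] e; first by rewrite hornerC; ring.
rewrite bernsteinS IH.
have -> : (fun k => c + d * (k%:R - e) ^+ 2) \o succn =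
    (fun k => c + d * (k%:R - (e - 1)) ^+ 2).
  by apply/funext => k /=; rewrite -natr1; ring.
by rewrite IH -natr1; ring.
Qed.

(** The error is at most [L] times the mean of [|k/N - x|]; bound this absolute
    value by [d + (k/N - x)^2 / d] and use the variance. *)
Lemma bernstein_approx g L x d n : lipschitz_on 0 1 g L -> 0 < L -> 0 < d ->
  0 <= x <= 1 ->
  `|(bernstein n.+1 (fun k => g (k%:R / n.+1%:R))).[x] - g x| <=
  L * (d + (d * n.+1%:R)^-1).
Proof.
move=> gL L0 d0 x01; set N : R := n.+1%:R.
have N0 : 0 < N by rewrite ltr0n.
have alg1 (M k : R) : 0 < M -> (d * M ^+ 2)^-1 * (k - M * x) ^+ 2 = d^-1 * (k / M - x) ^+ 2.
  by move=> M0; field; rewrite !gt_eqF.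
have alg2 (M : R) : 0 < M -> (d * M ^+ 2)^-1 * M = (d * M)^-1.
  by move=> M0; field; rewrite !gt_eqF.
have key k : (k <= n.+1)%N ->
    `|g (k%:R / N) - g x| <= L * (d + (d * N ^+ 2)^-1 * (k%:R - N * x) ^+ 2).
  move=> kn; apply: le_trans (gL _ _ _ x01) _.
    by rewrite divr_ge0 ?ler0n ?(ltW N0) //= ler_pdivrMr // mul1r ler_nat.
  rewrite ler_pM2l //; set t := k%:R / N - x.
  have -> : (d * N ^+ 2)^-1 * (k%:R - N * x) ^+ 2 = d^-1 * t ^+ 2.
    by rewrite /t alg1.
  have -> : t ^+ 2 = `|t| ^+ 2 by rewrite real_normK ?num_real.
  rewrite -(ler_pM2l d0) mulrDr mulrA mulfV ?gt_eqF // mul1r.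
  have := sqr_ge0 (d - `|t|); have := sqr_ge0 d; have := sqr_ge0 `|t|; nra.
have sq : N * x * (1 - x) + (N * x - N * x) ^+ 2 <= N.
  rewrite subrr expr0n addr0 -mulrA ler_piMr ?(ltW N0) //.
  by case/andP: x01 => x0 x1; nra.
have le : L * d + L * (d * N ^+ 2)^-1 * (N * x * (1 - x) + (N * x - N * x) ^+ 2)
    <= L * (d + (d * N)^-1).
  rewrite [leRHS]mulrDr lerD2l -mulrA ler_pM2l //.
  apply: le_trans (ler_wpM2l _ sq) _; first by rewrite invr_ge0 mulr_ge0 ?sqr_ge0 // ltW.
  by rewrite alg2.
rewrite ler_norml; apply/andP; split.
  rewrite lerBrDl; apply: le_trans (_ : g x - (L * d + L * (d * N ^+ 2)^-1 *
      (N * x * (1 - x) + (N * x - N * x) ^+ 2)) <= _); first by rewrite lerD2l lerN2.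
  rewrite opprD addrA -(mulNr (L * (d * N ^+ 2)^-1)).
  rewrite -(bernstein_quadratic n.+1 (g x - L * d)).
  apply: bernstein_le => // k /key; rewrite ler_norml mulrDr mulrA mulNr => /andP[h _].
  by move: h; rewrite lerBrDr addrC opprD addrA.
rewrite lerBlDl; apply: le_trans (_ : _ <= g x + (L * d + L * (d * N ^+ 2)^-1 *
      (N * x * (1 - x) + (N * x - N * x) ^+ 2))) _; last by rewrite lerD2l.
rewrite addrA -(bernstein_quadratic n.+1 (g x + L * d)).
apply: bernstein_le => // k /key; rewrite ler_norml mulrDr mulrA => /andP[_ h].
by move: h; rewrite lerBlDl addrA.
Qed.

Lemma lipschitz_approximable a b f L : a < b -> 0 < L -> lipschitz_on a b f L ->
  approximable a b f.
Proof.
move=> ab L0 fL e e0.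
pose w := b - a; have w0 : 0 < w by rewrite subr_gt0.
pose g u := f (a + u * w).
have Lw : 0 < L * w by rewrite mulr_gt0.
have in01 u : 0 <= u <= 1 -> a <= a + u * w <= b.
  by move=> /andP[u0 u1]; rewrite lerDl mulr_ge0 ?(ltW w0) //= /w; nra.
have gL : lipschitz_on 0 1 g (L * w).
  move=> x y x01 y01; apply: le_trans (fL _ _ (in01 _ x01) (in01 _ y01)) _.
  rewrite opprD addrACA subrr add0r -mulrBl normrM (gtr0_norm w0).
  by rewrite mulrA mulrAC.
pose d := e / (2 * (L * w)).
have d0 : 0 < d by rewrite divr_gt0 // mulr_gt0.
(* large enough for both error terms to be at most d *)
pose n := Num.truncn (d^-1 ^+ 2).
have nd : (d * n.+1%:R)^-1 <= d.
  have n1 : d^-1 ^+ 2 < n.+1%:R by exact: truncnS_gt.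
  rewrite invfM ler_pdivrMr ?ltr0n //.
  rewrite -ler_pdivrMl // -expr2; exact: ltW.
have hP x := @bernstein_approx g (L * w) x d n gL Lw d0.
move: (bernstein n.+1 _) hP => P hP.
exists (P \Po (w^-1%:P * ('X - a%:P))).
move=> l /andP[al lb]; rewrite horner_comp !hornerE.
have l01 : 0 <= w^-1 * (l - a) <= 1.
  rewrite mulr_ge0 ?invr_ge0 ?(ltW w0) ?subr_ge0 //= ler_pdivrMl // mulr1.
  by rewrite lerD2r.
have -> : f l = g (w^-1 * (l - a)).
  by rewrite /g mulrAC mulVf ?gt_eqF // mul1r addrC subrK.
apply: le_trans (hP _ l01) _.
apply: le_trans (_ : _ <= L * w * (d + d)) _; first by rewrite ler_pM2l // lerD2l.
by rewrite /d le_eqVlt; apply/orP; left; apply/eqP; field; rewrite !gt_eqF.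
Qed.

(** From [1 + x <= exp x] alone. *)
Lemma expR_lipschitz M u v : u <= M -> v <= M ->
  `|expR u - expR v| <= expR M * `|u - v|.
Proof.
have key x y : x <= M -> expR x - expR y <= expR M * `|x - y|.
  move=> xM; have e : expR y = expR x * expR (y - x) by rewrite -expRD addrC subrK.
  apply: le_trans (_ : expR x * (x - y) <= _).
    by rewrite e -{1}[expR x]mulr1 -mulrBr ler_pM2l ?expR_gt0 //;
      have := expR_ge1Dx (y - x); lra.
  apply: le_trans (_ : expR x * `|x - y| <= _); first by rewrite ler_pM2l ?expR_gt0 ?ler_norm.
  by rewrite ler_wpM2r // ler_expR.
move=> uM vM; rewrite ler_norml key // andbT lerNl opprB distrC; exact: key.
Qed.

(** From [1 + x <= exp x] at [x = ln (u / v)]. *)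
Lemma ln_lipschitz a x y : 0 < a -> a <= x -> a <= y ->
  `|ln x - ln y| <= a^-1 * `|x - y|.
Proof.
move=> a0.
have key u v : a <= u -> a <= v -> ln u - ln v <= a^-1 * `|u - v|.
  move=> au av; have u0 := lt_le_trans a0 au; have v0 := lt_le_trans a0 av.
  rewrite -ln_div ?posrE //.
  have := expR_ge1Dx (ln (u / v)); rewrite lnK ?posrE ?divr_gt0 // => h.
  apply: le_trans (_ : v^-1 * (u - v) <= _).
    by rewrite mulrBr mulVf ?gt_eqF // (mulrC v^-1) lerBrDl.
  apply: le_trans (_ : v^-1 * `|u - v| <= _).
    by rewrite ler_pM2l ?invr_gt0 // ler_norm.
  by rewrite ler_wpM2r // lef_pV2 ?posrE.
move=> ax ay; rewrite ler_norml key // andbT lerNl opprB distrC; exact: key.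
Qed.

Lemma ln_bounded a b x : 0 < a -> a <= x <= b -> `|ln x| <= Num.max `|ln a| `|ln b|.
Proof.
move=> a0 /andP[ax xb]; have x0 := lt_le_trans a0 ax; have b0 := lt_le_trans x0 xb.
have h1 : ln a <= ln x by rewrite ler_ln ?posrE.
have h2 : ln x <= ln b by rewrite ler_ln ?posrE.
rewrite le_max; have [l0|l0] := ger0P (ln x).
  by rewrite (le_trans h2 (ler_norm _)) orbT.
by rewrite -[`|ln a|]normrN (le_trans _ (ler_norm _)) // lerN2.
Qed.

Lemma powR_expR x s : 0 < x -> x `^ s = expR (s * ln x).
Proof. by move=> x0; rewrite /powR gt_eqF. Qed.

(** On positive numbers [x^s = exp (s ln x)], a composite of Lipschitz
    functions. *)
Lemma powR_lipschitz a b s : 0 < a -> exists2 L, 0 < L & lipschitz_on a b (fun l => l `^ s) L.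
Proof.
move=> a0; pose B := Num.max `|ln a| `|ln b|.
pose K := expR (`|s| * B) * `|s| * a^-1.
have K0 : 0 <= K by rewrite !mulr_ge0 ?expR_ge0 // invr_ge0 ltW.
exists (K + 1); first by rewrite ltr_wpDl.
move=> x y xab yab.
have x0 : 0 < x by case/andP: xab => /(lt_le_trans a0).
have y0 : 0 < y by case/andP: yab => /(lt_le_trans a0).
rewrite !powR_expR //.
have bd z : a <= z <= b -> s * ln z <= `|s| * B.
  move=> zab; apply: le_trans (ler_norm _) _; rewrite normrM ler_wpM2l //.
  exact: ln_bounded.
apply: le_trans (expR_lipschitz (bd x xab) (bd y yab)) _.
rewrite -mulrBr normrM mulrA.
apply: le_trans (_ : K * `|x - y| <= _); last by rewrite ler_wpM2r // lerDl.
rewrite /K -(mulrA _ a^-1) ler_wpM2l ?mulr_ge0 ?expR_ge0 //.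
by case/andP: xab => ? _; case/andP: yab => ? _; exact: ln_lipschitz.
Qed.

Lemma powR_bounded a b s : 0 < a -> exists2 F : R, 0 < F &
  forall l, a <= l <= b -> `|l `^ s| <= F.
Proof.
move=> a0; have [L L0 hL] := powR_lipschitz b s a0.
exists (`|a `^ s| + L * `|b - a| + 1).
  by rewrite ltr_wpDl // addr_ge0 // mulr_ge0 // ltW.
move=> l /andP[al lb].
have aab : a <= a <= b by rewrite lexx (le_trans al).
have lab : a <= l <= b by rewrite al.
have := hL l a lab aab; rewrite (ger0_norm (_ : 0 <= b - a)) ?(ger0_norm (_ : 0 <= l - a))
  ?subr_ge0 //; last by case/andP: aab.
move=> h; rewrite -[l `^ s](subrK (a `^ s)); apply: le_trans (ler_normD _ _) _.
rewrite addrC -addrA lerD2l; apply: le_trans h _; apply: le_trans (_ : L * (b - a) <= _).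
  by rewrite ler_pM2l // lerD2r.
by rewrite lerDl.
Qed.

Lemma powR_lipschitz_exponent a b : 0 < a -> exists2 K, 0 < K &
  forall x s s', a <= x <= b -> 0 <= s <= 1 -> 0 <= s' <= 1 ->
    `|x `^ s - x `^ s'| <= K * `|s - s'|.
Proof.
move=> a0; pose B := Num.max `|ln a| `|ln b|.
have B0 : 0 <= B by rewrite le_max normr_ge0.
exists (expR B * B + 1); first by rewrite ltr_wpDl // mulr_ge0 ?expR_ge0.
move=> x s s' xab s1 s1'.
have x0 : 0 < x by case/andP: xab => /(lt_le_trans a0).
rewrite !powR_expR //.
have bd r : 0 <= r <= 1 -> r * ln x <= B.
  move=> /andP[r0 r1]; apply: le_trans (ler_norm _) _; rewrite normrM ger0_norm //.
  by apply: le_trans (_ : `|ln x| <= _); [rewrite ler_piMl|exact: ln_bounded].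
apply: le_trans (expR_lipschitz (bd s s1) (bd s' s1')) _.
rewrite -mulrBl normrM (mulrC `|s - s'|) mulrA.
apply: ler_wpM2r => //; apply: le_trans (_ : expR B * B <= _); last by rewrite lerDl.
by rewrite ler_wpM2l ?expR_ge0 //; exact: ln_bounded.
Qed.

End Approximation.

(** * Polynomial and continuous functional calculus *)

Section PolynomialCalculus.
Variables (R : realType) (H : hilbertSpace R).
Implicit Types (x y z : H) (c d : R) (T X Y Z C U : operator H).

(** Complex coefficients are needed to split polynomials into linear factors. *)
Definition peval (p : {poly R[i]}) T : operator H :=
  \sum_(i < size p) p`_i *: T ^+ i.

Lemma peval_widen (p : {poly R[i]}) n T : (size p <= n)%N ->
  peval p T = \sum_(i < n) p`_i *: T ^+ i.
Proof.
move=> pn; rewrite /peval (big_ord_widen n (fun i => p`_i *: T ^+ i)) // big_mkcond /=.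
apply: eq_bigr => i _; case: ltnP => // /leq_sizeP -> //.
by rewrite scale0r.
Qed.

Lemma pevalD p q T : peval (p + q) T = peval p T + peval q T.
Proof.
pose n := maxn (size p) (size q).
rewrite !(@peval_widen _ n) ?leq_maxl ?leq_maxr ?size_polyD // -big_split /=.
by apply: eq_bigr => i _; rewrite coefD scalerDl.
Qed.

Lemma pevalZ a p T : peval (a *: p) T = a *: peval p T.
Proof.
rewrite !(@peval_widen _ (size p)) ?size_scale_leq // scaler_sumr.
by apply: eq_bigr => i _; rewrite coefZ scalerA.
Qed.

Lemma pevalC a T : peval a%:P T = a *: (1 : operator H).
Proof.
by rewrite (@peval_widen _ 1) ?size_polyC ?leq_b1 // big_ord1 coefC /= expr0.
Qed.

Lemma pevalMX p T : peval (p * 'X) T = peval p T * T.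
Proof.
rewrite (@peval_widen _ (size p).+1); last first.
  by rewrite (leq_trans (size_polyMleq _ _)) // size_polyX addn2.
rewrite big_ord_recl coefMX /= scale0r add0r /peval mulr_suml.
by apply: eq_bigr => i _; rewrite coefMX /= exprSr scaler_opAl.
Qed.

Lemma pevalX T : peval 'X T = T.
Proof. by rewrite -['X]mul1r pevalMX pevalC scale1r mul1r. Qed.

Lemma pevalM p q T : peval (p * q) T = peval p T * peval q T.
Proof.
elim/poly_ind: q => [|q a IH].
  by rewrite mulr0 -[0]/(0%:P) pevalC scale0r mulr0.
rewrite mulrDr !pevalD mulrA !pevalMX IH mulrDr mulrA; congr (_ + _).
by rewrite mulrC mul_polyC pevalZ pevalC -scaler_opAr mulr1.
Qed.

Lemma peval_prod (s : seq R[i]) T :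
  (forall l, l \in s -> invertible (T - l *: (1 : operator H))) ->
  invertible (peval (\prod_(l <- s) ('X - l%:P)) T).
Proof.
elim: s => [|z s IH] hs.
  by rewrite big_nil pevalC scale1r; exact: invertible1.
rewrite big_cons pevalM; apply: invertibleM; last first.
  by apply: IH => y ys; apply: hs; rewrite inE ys orbT.
by rewrite -polyCN pevalD pevalX pevalC scaleNr; apply: hs; rewrite inE eqxx.
Qed.

Notation real_poly := (map_poly (real_complex R)).

Lemma poly_operatorE (p : {poly R}) T : poly_operator p T = peval (real_poly p) T.
Proof.
by rewrite /poly_operator /peval size_map_poly; apply: eq_bigr => i _; rewrite coef_map.
Qed.

Lemma poly_operatorD p q T :
  poly_operator (p + q) T = poly_operator p T + poly_operator q T.
Proof. by rewrite !poly_operatorE rmorphD pevalD. Qed.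

Lemma poly_operatorM p q T :
  poly_operator (p * q) T = poly_operator p T * poly_operator q T.
Proof. by rewrite !poly_operatorE rmorphM pevalM. Qed.

Lemma poly_operatorC c T : poly_operator c%:P T = scalar_op H c.
Proof. by rewrite poly_operatorE map_polyC pevalC. Qed.

Lemma poly_operatorX T : poly_operator 'X T = T.
Proof. by rewrite poly_operatorE map_polyX pevalX. Qed.

Lemma poly_operatorN p T : poly_operator (- p) T = - poly_operator p T.
Proof.
by rewrite -mulN1r -polyCN poly_operatorM poly_operatorC scalar_opN scalar_op1 mulN1r.
Qed.

Lemma poly_operatorB p q T :
  poly_operator (p - q) T = poly_operator p T - poly_operator q T.
Proof. by rewrite poly_operatorD poly_operatorN. Qed.

Lemma poly_operator_selfadjoint p T : selfadjoint T -> selfadjoint (poly_operator p T).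
Proof.
move=> sT; elim/poly_ind: p => [|p c IH].
  by rewrite -[0]/(0%:P) poly_operatorC; exact: selfadjoint_scalar.
rewrite poly_operatorD poly_operatorM poly_operatorC poly_operatorX.
apply: selfadjointD; last exact: selfadjoint_scalar.
apply: selfadjoint_comm => //.
by rewrite -[X in _ * X = _](poly_operatorX T) -poly_operatorM mulrC poly_operatorM poly_operatorX.
Qed.

Lemma poly_operator_intertwine p T X U : T * X = X * U ->
  poly_operator p T * X = X * poly_operator p U.
Proof.
move=> TX; elim/poly_ind: p => [|p c IH].
  by rewrite -[0]/(0%:P) !poly_operatorC scalar_opC.
rewrite !poly_operatorD !poly_operatorM !poly_operatorC !poly_operatorX.
by rewrite mulrDl mulrDr scalar_opC -mulrA TX !mulrA IH.
Qed.

(** Over the complex numbers [p] splits into factors [X - z]. A root [z] is either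
    not real, and then outside the spectrum by self-adjointness, or a real root
    of [p], and then outside the spectrum by hypothesis. *)
Lemma poly_operator_invertible p T : selfadjoint T ->
  (forall l : R, spectrum T l%:C%C -> p.[l] != 0) ->
  p != 0 -> invertible (poly_operator p T).
Proof.
move=> sT hp p0; rewrite poly_operatorE.
set q := real_poly p.
have [s qs] := closed_field_poly_normal q.
have q0 : lead_coef q != 0 by rewrite lead_coef_eq0 map_poly_eq0.
rewrite qs pevalZ; apply: invertibleZ => //; apply: peval_prod => z zs.
have /rootP qz : root q z by rewrite qs rootZ // root_prod_XsubC.
case: z zs qz => a b _; have [->|b0] := eqVneq b 0; last by move=> _; exact: spectrum_real.
rewrite -[(a +i* 0)%C]/(a%:C%C) /q horner_map => /complexI pa.
apply: contrapT => na.
by have := hp a na; rewrite pa eqxx.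
Qed.

(** No number [l > c] is a value of [p] on the spectrum, so [p(T) - l] is
    invertible, and the previous bound on the top of the spectrum applies. *)
Lemma poly_operator_le p T c : selfadjoint T ->
  (forall l : R, spectrum T l%:C%C -> p.[l] <= c) ->
  scalar_op H c >=% poly_operator p T.
Proof.
move=> sT hp; apply: le_of_invertible; first exact: poly_operator_selfadjoint.
move=> l cl.
rewrite -(poly_operatorC l T) -poly_operatorB.
have [p0|p0] := eqVneq (p - l%:P) 0; last first.
  apply: poly_operator_invertible => // m hm.
  by rewrite !hornerE subr_eq0 lt_eqF // (le_lt_trans (hp _ hm)).
have pl : p = l%:P by apply/eqP; rewrite -subr_eq0 p0.
(* a constant p exceeding c forces the spectrum to be empty, hence H = 0 *)
have iT d : invertible (T - scalar_op H d).
  apply: contrapT => nd; have := hp d nd.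
  by rewrite pl hornerC leNgt cl.
have [M M0 TM] := bounded_byP T.
have [_ TlM] := bounded_by_ge M0 sT TM.
have TuM : scalar_op H (- M - 1) >=% T by apply: le_of_invertible.
have H0 x : x = 0.
  apply: rnorm_le0.
  have := operator_ge_rinner x (operator_ge_trans TuM TlM).
  rewrite !opE !rinnerZl rinnerxx => h.
  have : rnorm x ^+ 2 <= 0 by lra.
  by rewrite le_eqVlt ltNge sqr_ge0 orbF sqrf_eq0 => /eqP ->.
rewrite p0 -[0]/(0%:P) poly_operatorC scalar_op0; exists 0.
by split; apply: operatorP => x; rewrite [LHS]H0 [RHS]H0.
Qed.

Lemma poly_operator_bounded p T c : selfadjoint T -> 0 < c ->
  (forall l : R, spectrum T l%:C%C -> `|p.[l]| <= c) ->
  bounded_by (poly_operator p T) c.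
Proof.
move=> sT c0 hp; apply: bounded_by_selfadjoint => //.
  by apply: poly_operator_le => // l /hp; rewrite ler_norml => /andP[].
rewrite -[poly_operator p T]opprK -poly_operatorN scalar_opN.
apply: operator_ge_opp; apply: poly_operator_le => // l /hp.
by rewrite ler_norml hornerN lerNl => /andP[].
Qed.

Lemma is_fcalcP f T X : is_fcalc f T X <->
  forall e : R, 0 < e -> exists p : {poly R},
    (forall l : R, spectrum T l%:C%C -> `|p.[l] - f l| <= e) /\
    bounded_by (poly_operator p T - X) e.
Proof.
by split=> h e e0; have [p [pf pX]] := h e e0; exists p; split=> //;
  apply/operator_normP => //; exact: ltW.
Qed.

Lemma is_fcalc_uniq f T X Y : selfadjoint T ->
  is_fcalc f T X -> is_fcalc f T Y -> X = Y.
Proof.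
move=> sT /is_fcalcP hX /is_fcalcP hY; apply/eqP; rewrite -subr_eq0; apply/eqP.
apply: bounded_by_eq0 => e e0.
have e4 : 0 < e / 4 by rewrite divr_gt0.
have [p [pf pX]] := hX _ e4; have [q [qf qY]] := hY _ e4.
have pq : bounded_by (poly_operator (p - q) T) (e / 2).
  apply: poly_operator_bounded => //; first by rewrite divr_gt0.
  move=> l hl; rewrite hornerD hornerN.
  have := pf l hl; have := qf l hl; rewrite !ler_norml => /andP[? ?] /andP[? ?].
  by apply/andP; split; lra.
have -> : X - Y = poly_operator (p - q) T - (poly_operator p T - X)
    + (poly_operator q T - Y).
  by rewrite poly_operatorB opprB (addrC _ (X - _)) (addrA (X - _)) subrK addrA subrK.
have -> : e = e / 2 + e / 4 + e / 4 by lra.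
by apply: bounded_byD => //; apply: bounded_byB.
Qed.

Lemma fcalc_eq f T X : selfadjoint T -> is_fcalc f T X -> fcalc f T = X.
Proof.
move=> sT hX; apply: is_fcalc_uniq sT _ (hX).
by apply: xgetPex; exists X.
Qed.

(** Approximation on an interval containing the spectrum is stable under
    composition of functions without knowing the spectrum of [f(T)]. *)
Definition interval_fcalc a b f T X :=
  forall e : R, 0 < e -> exists p : {poly R},
    (forall l, a <= l <= b -> `|p.[l] - f l| <= e) /\
    bounded_by (poly_operator p T - X) e.

Definition spectrum_in a b T := T >=% scalar_op H a /\ scalar_op H b >=% T.

Lemma spectrum_in_selfadjoint a b T : spectrum_in a b T -> selfadjoint T.
Proof. by move=> [/operator_geE[]]. Qed.

Lemma spectrum_inP a b T l : spectrum_in a b T -> spectrum T l%:C%C -> a <= l <= b.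
Proof.
move=> [aT Tb] nl; have sT := (operator_geE aT).1.
apply/andP; split; rewrite leNgt; apply/negP => hl; apply: nl.
  apply: (@invertible_ge _ _ _ (a - l)); first by rewrite subr_gt0.
  rewrite scalar_opD scalar_opN -/(scalar_op H l); apply: operator_geB => //.
  exact: selfadjoint_scalar.
have -> : T - l%:C%C *: (1 : operator H) = -1 *: (- (T - scalar_op H l)).
  by rewrite scaleN1r opprK.
apply: invertibleZ; first by rewrite oppr_eq0 oner_eq0.
apply: (@invertible_ge _ _ _ (l - b)); first by rewrite subr_gt0.
have -> : scalar_op H (l - b) = - (scalar_op H b - scalar_op H l).
  by rewrite opprB scalar_opD scalar_opN.
by apply/operator_ge_opp/operator_geB => //; exact: selfadjoint_scalar.
Qed.

Lemma interval_fcalc_is_fcalc a b f T X :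
  spectrum_in a b T -> interval_fcalc a b f T X -> is_fcalc f T X.
Proof.
move=> abT h; apply/is_fcalcP => e /h[p [pf pX]]; exists p; split=> // l hl.
exact/pf/(spectrum_inP abT).
Qed.

Lemma fcalcE a b f T X : spectrum_in a b T -> interval_fcalc a b f T X -> fcalc f T = X.
Proof.
move=> abT hX; apply: fcalc_eq; first exact: spectrum_in_selfadjoint abT.
exact: interval_fcalc_is_fcalc hX.
Qed.

Lemma interval_fcalc_poly a b p T : interval_fcalc a b (horner p) T (poly_operator p T).
Proof.
move=> e e0; exists p; split=> [l _|x]; first by rewrite subrr normr0 ltW.
by rewrite subrr op0E rnorm0 mulr_ge0 ?rnorm_ge0 // ltW.
Qed.

Lemma interval_fcalc_ext a b f g T X : (forall l, a <= l <= b -> f l = g l) ->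
  interval_fcalc a b f T X -> interval_fcalc a b g T X.
Proof.
move=> fg h e /h[p [pf pX]]; exists p; split=> // l hl.
by rewrite -fg // pf.
Qed.

Lemma interval_fcalcD a b f g T X Y :
  interval_fcalc a b f T X -> interval_fcalc a b g T Y ->
  interval_fcalc a b (fun l => f l + g l) T (X + Y).
Proof.
move=> hX hY e e0; have e2 : 0 < e / 2 by rewrite divr_gt0.
have [p [pf pX]] := hX _ e2; have [q [qg qY]] := hY _ e2.
exists (p + q); split=> [l hl|].
  rewrite hornerD opprD addrACA (splitr e); apply: le_trans (ler_normD _ _) _.
  by apply: lerD; [exact: pf|exact: qg].
by rewrite poly_operatorD opprD addrACA (splitr e); apply: bounded_byD.
Qed.

(** The polynomials approximating [f(T)] may depend on the operator; this makes
    one polynomial work for all operators with spectrum in the interval. *)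
Lemma interval_fcalc_approx a b f T X p e : spectrum_in a b T ->
  interval_fcalc a b f T X -> 0 < e ->
  (forall l, a <= l <= b -> `|p.[l] - f l| <= e) ->
  bounded_by (poly_operator p T - X) (2 * e).
Proof.
move=> abT hX e0 pf; have e2 : 0 < e / 2 by rewrite divr_gt0.
have [q [qf qX]] := hX _ e2.
have -> : poly_operator p T - X = poly_operator (p - q) T + (poly_operator q T - X).
  by rewrite poly_operatorB addrA subrK.
have -> : 2 * e = (e + e / 2) + e / 2 by lra.
apply: bounded_byD => //; apply: poly_operator_bounded.
- exact: spectrum_in_selfadjoint abT.
- by rewrite addr_gt0.
- move=> l /(spectrum_inP abT) hl; rewrite hornerD hornerN.
  have := pf l hl; have := qf l hl; rewrite !ler_norml => /andP[? ?] /andP[? ?].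
  by apply/andP; split; lra.
Qed.

Lemma interval_fcalc_bounded a b f T X F : spectrum_in a b T ->
  interval_fcalc a b f T X -> 0 < F ->
  (forall l, a <= l <= b -> `|f l| <= F) -> bounded_by X F.
Proof.
move=> abT hX F0 fF x; apply/ler_addgt0Pr => e e0.
have n0 : 0 < 2 * (rnorm x + 1) by rewrite mulr_gt0 // ltr_wpDl // rnorm_ge0.
have d0 : 0 < e / (2 * (rnorm x + 1)) by rewrite divr_gt0.
have [p [pf pX]] := hX _ d0; set d := e / _ in d0 pf pX.
have pF : bounded_by (poly_operator p T) (F + d).
  apply: poly_operator_bounded; rewrite ?addr_gt0 //.
    exact: spectrum_in_selfadjoint abT.
  move=> l /(spectrum_inP abT) hl.
  have := pf l hl; have := fF l hl; rewrite !ler_norml => /andP[? ?] /andP[? ?].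
  by apply/andP; split; lra.
have := bounded_byB pF pX; rewrite opprB addrC subrK => /(_ x) /le_trans; apply.
rewrite mulrDl mulrDl -addrA lerD2l.
have -> : d * rnorm x + d * rnorm x = d * (2 * rnorm x) by lra.
rewrite /d -mulrA ger_pMr // ler_pdivrMl // mulr1; lra.
Qed.

Lemma rinner_bounded Z e x y : 0 < e -> bounded_by Z e ->
  `|2 * rinner (Z x) y| <= e * (rnorm x ^+ 2 + rnorm y ^+ 2).
Proof.
move=> e0.
have key W : bounded_by W e -> 2 * rinner (W x) y <= e * (rnorm x ^+ 2 + rnorm y ^+ 2).
  move=> We; apply: le_trans (rinner_le _ _ e0) _.
  rewrite mulrDr lerD2r ler_pdivrMl // mulrA -expr2 -exprMn.
  by rewrite ler_sqr ?We // nnegrE ?rnorm_ge0 // mulr_ge0 ?rnorm_ge0 ?(ltW e0).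
move=> Ze; rewrite ler_norml key // andbT lerNl -mulrN -rinnerNl -opNE.
by rewrite key //; exact: bounded_byN.
Qed.

Lemma interval_fcalc_selfadjoint a b f T X : spectrum_in a b T ->
  interval_fcalc a b f T X -> selfadjoint X.
Proof.
move=> abT hX; apply/selfadjointP => x y; apply/eqP; rewrite -subr_eq0 -normr_le0.
apply/ler_addgt0Pr => e e0; rewrite add0r.
set n := rnorm x ^+ 2 + rnorm y ^+ 2.
have n0 : 0 <= n by rewrite addr_ge0 ?exprn_ge0 ?rnorm_ge0.
have n1 : 0 < n + 1 by rewrite ltr_wpDl.
have d0 : 0 < e / (n + 1) by rewrite divr_gt0.
have [p [pf pX]] := hX _ d0.
have h1 := rinner_bounded x y d0 pX; have h2 := rinner_bounded y x d0 pX.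
rewrite (addrC (rnorm y ^+ 2)) in h2.
have sp := poly_operator_selfadjoint p (spectrum_in_selfadjoint abT).
have := (selfadjointP _).1 sp x y.
move: h1 h2; rewrite !opBE !rinnerBl -/n !(rinnerC (X y)) !(rinnerC (poly_operator p T y)).
have : e / (n + 1) * n <= e by rewrite -mulrA ger_pMr // ler_pdivrMl // mulr1 lerDl ler01.
rewrite !ler_norml => h /andP[h1 h2] /andP[h3 h4] h5.
by apply/andP; split; lra.
Qed.

Lemma interval_fcalc_le a b f T X c : spectrum_in a b T ->
  interval_fcalc a b f T X ->
  (forall l, a <= l <= b -> f l <= c) -> scalar_op H c >=% X.
Proof.
move=> abT hX fc; apply/operator_geP; split.
- exact: selfadjoint_scalar.
- exact: interval_fcalc_selfadjoint hX.
move=> x; rewrite opE rinnerZl rinnerxx; apply/ler_addgt0Pr => e e0.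
have n0 : 0 <= rnorm x ^+ 2 by rewrite exprn_ge0 ?rnorm_ge0.
have n1 : 0 < 2 * (rnorm x ^+ 2 + 1) by rewrite mulr_gt0 // ltr_wpDl.
have d0 : 0 < e / (2 * (rnorm x ^+ 2 + 1)) by rewrite divr_gt0.
have [p [pf pX]] := hX _ d0; set d := e / _ in d0 pf pX.
have dn : 2 * d * rnorm x ^+ 2 <= e.
  by rewrite mulrAC mulrC /d -mulrA ger_pMr // ler_pdivrMl // mulr1 mulrDr mulr1 lerDl.
have sT := spectrum_in_selfadjoint abT.
have : scalar_op H (c + d) >=% poly_operator p T.
  apply: poly_operator_le => // l /(spectrum_inP abT) hl.
  have := pf l hl; have := fc l hl; rewrite !ler_norml => ? /andP[? ?]; lra.
move=> /(operator_ge_rinner x); rewrite opE rinnerZl rinnerxx => h1.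
have := rinner_bounded x x d0 pX.
rewrite opBE rinnerBl ler_norml => /andP[h2 _]; lra.
Qed.

Lemma interval_fcalcN a b f T X : interval_fcalc a b f T X ->
  interval_fcalc a b (fun l => - f l) T (- X).
Proof.
move=> hX e /hX[p [pf pX]]; exists (- p); split=> [l hl|].
  by rewrite hornerN -opprD normrN pf.
by rewrite poly_operatorN -opprD; exact: bounded_byN.
Qed.

Lemma interval_fcalc_ge a b f T X c : spectrum_in a b T ->
  interval_fcalc a b f T X ->
  (forall l, a <= l <= b -> c <= f l) -> X >=% scalar_op H c.
Proof.
move=> abT hX fc; rewrite -[X]opprK -[c]opprK scalar_opN; apply: operator_ge_opp.
apply: (interval_fcalc_le abT (interval_fcalcN hX)) => l /fc.
by rewrite lerN2.
Qed.

Lemma interval_fcalcM a b f g T X Y F G : spectrum_in a b T ->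
  (forall l, a <= l <= b -> `|f l| <= F) -> (forall l, a <= l <= b -> `|g l| <= G) ->
  0 < F -> 0 < G ->
  interval_fcalc a b f T X -> interval_fcalc a b g T Y ->
  interval_fcalc a b (fun l => f l * g l) T (X * Y).
Proof.
move=> abT fF gG F0 G0 hX hY e e0.
pose d := Num.min 1 (e / (F + G + 1)).
have FG : 0 < F + G + 1 by rewrite !addr_gt0.
have d0 : 0 < d by rewrite lt_min ltr01 divr_gt0.
have d1 : d <= 1 by rewrite ge_min lexx.
have de : d * (F + G + 1) <= e by rewrite -ler_pdivlMr // ge_min lexx orbT.
have [p [pf pX]] := hX _ d0; have [q [qg qY]] := hY _ d0.
have qG l : a <= l <= b -> `|q.[l]| <= G + 1.
  move=> hl; rewrite -(subrK (g l) q.[l]) addrC; apply: le_trans (ler_normD _ _) _.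
  by rewrite lerD ?gG // (le_trans (qg _ hl)).
exists (p * q); split=> [l hl|].
  have -> : (p * q).[l] - f l * g l = (p.[l] - f l) * q.[l] + f l * (q.[l] - g l).
    by rewrite hornerM; ring.
  apply: le_trans de; apply: le_trans (ler_normD _ _) _.
  have -> : d * (F + G + 1) = d * (G + 1) + F * d by ring.
  by rewrite !normrM; apply: lerD; apply: ler_pM => //; [exact: pf|exact: qG|exact: fF|exact: qg].
have -> : poly_operator (p * q) T - X * Y =
    (poly_operator p T - X) * poly_operator q T + X * (poly_operator q T - Y).
  by rewrite poly_operatorM mulrBl mulrBr addrA subrK.
apply: bounded_byW de _.
have -> : d * (F + G + 1) = d * (G + 1) + F * d by ring.
apply: bounded_byD; apply: bounded_byM => //; try exact: ltW.
  apply: poly_operator_bounded; rewrite ?addr_gt0 //.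
    exact: spectrum_in_selfadjoint abT.
  by move=> l /(spectrum_inP abT); exact: qG.
exact: interval_fcalc_bounded hX F0 fF.
Qed.

Lemma interval_fcalc_intertwine a b f T U X Y Z : spectrum_in a b T -> spectrum_in a b U ->
  interval_fcalc a b f T X -> interval_fcalc a b f U Y ->
  T * Z = Z * U -> X * Z = Z * Y.
Proof.
move=> abT abU hX hY TZ; apply/eqP; rewrite -subr_eq0; apply/eqP.
have [d d0 Zd] := bounded_byP Z.
apply: bounded_by_eq0 => e e0.
have d0' : 0 < e / (3 * d) by rewrite divr_gt0 // mulr_gt0.
have [p [pf pX]] := hX _ d0'.
have pY := interval_fcalc_approx abU hY d0' pf.
have -> : X * Z - Z * Y = Z * (poly_operator p U - Y) - (poly_operator p T - X) * Z.
  by rewrite mulrBr mulrBl (poly_operator_intertwine _ TZ) opprB [RHS]addrC addrA subrK.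
have -> : e = d * (2 * (e / (3 * d))) + e / (3 * d) * d by field; rewrite gt_eqF.
by apply: bounded_byB; apply: bounded_byM => //; exact: ltW.
Qed.

(** By induction on [q]; the boundedness of [q o f] is carried along because
    products need it. *)
Lemma interval_fcalc_polyM a b f T X q : spectrum_in a b T ->
  (exists F, forall l, a <= l <= b -> `|f l| <= F) ->
  interval_fcalc a b f T X ->
  interval_fcalc a b (fun l => q.[f l]) T (poly_operator q X).
Proof.
move=> abT [F fF] hX.
suff : interval_fcalc a b (fun l => q.[f l]) T (poly_operator q X) /\
  exists2 G, 0 < G & forall l, a <= l <= b -> `|q.[f l]| <= G by case.
elim/poly_ind: q => [|q c [IH [G G0 hG]]].
  rewrite -[0]/(0%:P) poly_operatorC -(poly_operatorC 0 T); split.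
    apply: interval_fcalc_ext (interval_fcalc_poly _ _ _ _) => l _.
    by rewrite !hornerC.
  by exists 1 => // l _; rewrite hornerC normr0.
have F1 : 0 < `|F| + 1 by rewrite ltr_wpDl.
have fF1 l : a <= l <= b -> `|f l| <= `|F| + 1.
  by move=> /fF /le_trans; apply; rewrite (le_trans (ler_norm _)) // lerDl.
rewrite poly_operatorD poly_operatorM poly_operatorX poly_operatorC; split.
  rewrite -(poly_operatorC c T).
  apply: interval_fcalc_ext (interval_fcalcD (interval_fcalcM abT hG fF1 G0 F1 IH hX)
    (interval_fcalc_poly _ _ _ _)) => l _.
  by rewrite hornerMXaddC hornerC.
exists (G * (`|F| + 1) + `|c| + 1).
  by rewrite ltr_wpDl // addr_ge0 // mulr_ge0 // ltW.
move=> l hl; rewrite hornerMXaddC; apply: le_trans (ler_normD _ _) _.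
rewrite -addrA lerD //; last by rewrite lerDl.
by rewrite normrM ler_pM // ?hG // fF1.
Qed.

(** Approximate [g] by a polynomial [q]; then [q(f(T))] is covered by the
    previous lemma. *)
Lemma interval_fcalc_comp a b a' b' f g T X Y : spectrum_in a b T ->
  (forall l, a <= l <= b -> a' <= f l <= b') ->
  interval_fcalc a b f T X -> interval_fcalc a' b' g X Y ->
  interval_fcalc a b (fun l => g (f l)) T Y.
Proof.
move=> abT fab hX hY e e0; have e2 : 0 < e / 2 by rewrite divr_gt0.
have [q [qg qY]] := hY _ e2.
have fF : exists F, forall l, a <= l <= b -> `|f l| <= F.
  exists (Num.max `|a'| `|b'|) => l /fab /andP[h1 h2].
  rewrite le_max; have [f0|f0] := ger0P (f l).
    by rewrite (le_trans h2 (ler_norm _)) orbT.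
  by rewrite -normrN (le_trans _ (ler_norm _)) // lerN2.
have [p [pq pX]] := interval_fcalc_polyM q abT fF hX e2.
exists p; split=> [l hl|].
  have := pq l hl; have := qg _ (fab l hl); rewrite !ler_norml => /andP[? ?] /andP[? ?].
  by apply/andP; split; lra.
have -> : poly_operator p T - Y =
    (poly_operator p T - poly_operator q X) + (poly_operator q X - Y).
  by rewrite addrA subrK.
by rewrite (splitr e); exact: bounded_byD.
Qed.

(** The operators [p_k(T)] form a Cauchy sequence, since the difference of two
    approximations is a polynomial that is small on the spectrum. *)
Lemma interval_fcalc_ex a b f T : spectrum_in a b T -> approximable a b f ->
  exists X, interval_fcalc a b f T X.
Proof.
move=> abT fa.
have k0 k : 0 < (k.+1%:R : R)^-1 by rewrite invr_gt0.
have [p pf] := choice (fun k => fa _ (k0 k)).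
have small d : 0 < d -> exists k, 2 * (k.+1%:R : R)^-1 < d.
  move=> d0; exists (Num.truncn (2 / d)).
  by rewrite ltr_pdivrMr // mulrC -ltr_pdivrMr // truncnS_gt.
(* the constant 2 covers the errors of both polynomials *)
have [k l kl|X hX] := @operator_complete _ _ (fun k => poly_operator (p k) T) _ small.
  have hle : (l.+1%:R : R)^-1 <= k.+1%:R^-1 by rewrite lef_pV2 ?posrE // ler_nat.
  rewrite -poly_operatorB; apply: poly_operator_bounded; rewrite ?mulr_gt0 //.
    exact: spectrum_in_selfadjoint abT.
  move=> m /(spectrum_inP abT) hm; rewrite hornerD hornerN.
  have := pf k m hm; have := pf l m hm; rewrite !ler_norml => /andP[+ +] /andP[+ +].
  move: (l.+1%:R^-1 : R) (k.+1%:R^-1 : R) hle => u v uv h1 h2 h3 h4.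
  by apply/andP; split; lra.
exists X => e e0; have [k ke] := small _ e0.
exists (p k); split=> [l hl|]; last by apply: bounded_byW (hX k); exact: ltW.
apply: le_trans (pf k l hl) (ltW (le_lt_trans _ ke)).
by rewrite ler_peMl // ?ler1n // ltW.
Qed.

End PolynomialCalculus.

(** * Real powers of positive definite operators *)

Fact power_key : unit. Proof. by []. Qed.

(** Powers are used from here on only through the laws proved in this section,
    so their definition is sealed. *)
Definition locked_power (R : realType) (H : hilbertSpace R) : operator H -> R -> operator H :=
  locked_with power_key (@operator_power R H).

Lemma locked_powerE (R : realType) (H : hilbertSpace R) :
  @locked_power R H = @operator_power R H.
Proof. exact: locked_withE. Qed.

Section Powers.
Variables (R : realType) (H : hilbertSpace R).
Implicit Types (x y z : H) (a b c d s : R) (T X Y Z C U : operator H).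

Local Notation "T ^^ a" := (locked_power T a) : ring_scope.

Lemma positive_definite_spectrum T : positive_definite T ->
  exists a b, [/\ 0 < a, a < b & spectrum_in a b T].
Proof.
move=> /positive_definite_ge[a a0 aT]; have sT := (operator_geE aT).1.
have [M M0 TM] := bounded_byP T; have [TuM _] := bounded_by_ge M0 sT TM.
(* approximation needs an interval of positive length *)
exists a, (Num.max M (a + 1)); split=> //; first by rewrite lt_max ltrDl ltr01 orbT.
split=> //; apply: operator_ge_trans TuM.
by apply: operator_ge_scalar; rewrite le_max lexx.
Qed.

Lemma spectrum_inW a b a' b' T : a' <= a -> b <= b' ->
  spectrum_in a b T -> spectrum_in a' b' T.
Proof.
move=> a'a bb' [aT Tb]; split.
  exact: operator_ge_trans aT (operator_ge_scalar _ a'a).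
exact: operator_ge_trans (operator_ge_scalar _ bb') Tb.
Qed.

Lemma positive_definite_spectrum2 T U : positive_definite T -> positive_definite U ->
  exists a b, [/\ 0 < a, a < b, spectrum_in a b T & spectrum_in a b U].
Proof.
move=> /positive_definite_spectrum[a [b [a0 ab abT]]].
move=> /positive_definite_spectrum[a' [b' [a'0 ab' abU]]].
exists (Num.min a a'), (Num.max b b'); split.
- by rewrite lt_min a0.
- by rewrite lt_max gt_min ab.
- by apply: spectrum_inW abT; rewrite ?ge_min ?le_max lexx.
- by apply: spectrum_inW abU; rewrite ?ge_min ?le_max lexx orbT.
Qed.

Lemma positive_definite_selfadjoint T : positive_definite T -> selfadjoint T.
Proof. by move=> [/positive_selfadjoint]. Qed.

Lemma power_interval a b s T : 0 < a -> a < b -> spectrum_in a b T ->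
  interval_fcalc a b (fun l => l `^ s) T (T ^^ s).
Proof.
move=> a0 ab abT; have [L L0 hL] := powR_lipschitz b s a0.
have [X hX] := interval_fcalc_ex abT (lipschitz_approximable ab L0 hL).
by rewrite locked_powerE /operator_power (fcalcE abT hX).
Qed.

Lemma power_eq a b s T X : spectrum_in a b T ->
  interval_fcalc a b (fun l => l `^ s) T X -> T ^^ s = X.
Proof. by move=> abT hX; rewrite locked_powerE; exact: fcalcE hX. Qed.

Lemma powerD T s s' : positive_definite T -> T ^^ (s + s') = T ^^ s * T ^^ s'.
Proof.
move=> /positive_definite_spectrum[a [b [a0 ab abT]]].
apply: (power_eq abT).
have [F F0 hF] := powR_bounded b s a0; have [G G0 hG] := powR_bounded b s' a0.
apply: interval_fcalc_ext (interval_fcalcM abT hF hG F0 G0 (power_interval _ a0 ab abT)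
  (power_interval _ a0 ab abT)) => l /andP[al _].
by rewrite powRD // (gt_eqF (lt_le_trans a0 al)) implybT.
Qed.

Lemma power0 T : positive_definite T -> T ^^ 0 = 1.
Proof.
move=> /positive_definite_spectrum[a [b [a0 ab abT]]].
apply: (power_eq abT); rewrite -(scalar_op1 H) -(poly_operatorC 1 T).
apply: interval_fcalc_ext (interval_fcalc_poly _ _ _ _) => l _.
by rewrite hornerC powRr0.
Qed.

Lemma power1 T : positive_definite T -> T ^^ 1 = T.
Proof.
move=> /positive_definite_spectrum[a [b [a0 ab abT]]].
apply: (power_eq abT); rewrite -{2}(poly_operatorX T).
apply: interval_fcalc_ext (interval_fcalc_poly _ _ _ _) => l /andP[al _].
by rewrite hornerX powRr1 // ltW // (lt_le_trans a0 al).
Qed.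

Lemma power_is_inverse T s : positive_definite T -> is_inverse (T ^^ s) (T ^^ (- s)).
Proof.
by move=> pT; split; rewrite -powerD // ?subrr ?addNr power0.
Qed.

Lemma power_positive_definite T s : positive_definite T -> positive_definite (T ^^ s).
Proof.
move=> pT; split; last by exists (T ^^ (- s)); exact: power_is_inverse.
have [a [b [a0 ab abT]]] := positive_definite_spectrum pT.
apply/positive_ge0; rewrite -(scalar_op0 H).
by apply: (interval_fcalc_ge abT (power_interval _ a0 ab abT)) => l _; exact: powR_ge0.
Qed.

Lemma power_selfadjoint T s : positive_definite T -> selfadjoint (T ^^ s).
Proof. by move=> /power_positive_definite/positive_definite_selfadjoint; apply. Qed.

(** The values [l^s] stay in a compact interval of positive numbers, which also
    contains the spectrum of [T^s], so the composition rule applies there. *)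
Lemma powerM T s s' : positive_definite T -> (T ^^ s) ^^ s' = T ^^ (s * s').
Proof.
move=> /positive_definite_spectrum[a [b [a0 ab abT]]].
have [F F0 hF] := powR_bounded b s a0; have [G G0 hG] := powR_bounded b (- s) a0.
have Gi : 0 < G^-1 by rewrite invr_gt0.
have hl l : a <= l <= b -> G^-1 <= l `^ s <= F + G^-1 + 1.
  move=> lab; have l0 : 0 < l by case/andP: lab => /(lt_le_trans a0).
  have lF := le_trans (ler_norm _) (hF l lab); have lG := le_trans (ler_norm _) (hG l lab).
  apply/andP; split; last by lra.
  by rewrite -[l `^ s]invrK lef_pV2 ?posrE ?invr_gt0 ?powR_gt0 // -powRN.
have hs := power_interval s a0 ab abT.
have ab' : spectrum_in G^-1 (F + G^-1 + 1) (T ^^ s).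
  split; first by apply: (interval_fcalc_ge abT hs) => l /hl /andP[].
  by apply: (interval_fcalc_le abT hs) => l /hl /andP[].
apply/esym; apply: (power_eq abT).
apply: interval_fcalc_ext (interval_fcalc_comp abT hl hs (power_interval s' Gi _ ab')).
  by move=> l lab; rewrite powRrM.
lra.
Qed.

Lemma power_intertwine T U Z s : positive_definite T -> positive_definite U ->
  T * Z = Z * U -> T ^^ s * Z = Z * U ^^ s.
Proof.
move=> pT pU; have [a [b [a0 ab abT abU]]] := positive_definite_spectrum2 pT pU.
exact: interval_fcalc_intertwine abT abU (power_interval _ a0 ab abT)
  (power_interval _ a0 ab abU).
Qed.

Lemma power_nat T n : positive_definite T -> T ^^ n%:R = T ^+ n.
Proof.
move=> pT; elim: n => [|n IH]; first by rewrite expr0 power0.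
by rewrite -natr1 powerD // IH power1 // exprSr.
Qed.

Lemma powerK T s : positive_definite T -> s != 0 -> (T ^^ s) ^^ s^-1 = T.
Proof. by move=> pT s0; rewrite powerM // mulfV // power1. Qed.

Lemma powerVK T s : positive_definite T -> s != 0 -> (T ^^ s^-1) ^^ s = T.
Proof. by move=> pT s0; rewrite powerM // mulVf // power1. Qed.

(** [XY] and [YX] are intertwined by [X]. *)
Lemma power_mulC X Y s : positive_definite (X * Y) -> positive_definite (Y * X) ->
  (X * Y) ^^ s = X * (Y * X) ^^ (s - 1) * Y.
Proof.
move=> pXY pYX.
rewrite -(power_intertwine _ pXY pYX (esym (mulrA X Y X))).
by rewrite -mulrA -{3}(power1 pXY) -powerD // subrK.
Qed.

Lemma positive_definite_conj C X : positive_definite C -> positive_definite X ->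
  positive_definite (C * X * C).
Proof.
move=> pC [pX iX]; have sC := positive_definite_selfadjoint pC.
split; last by apply: invertibleM pC.2; apply: invertibleM iX; exact: pC.2.
apply/positive_ge0; rewrite -(mulr0 C) -(mul0r C) mulrA; apply: operator_ge_conj => //.
exact/positive_ge0.
Qed.

End Powers.

(** * Loewner-Heinz and Furuta inequalities *)

Section Inequalities.
Variables (R : realType) (H : hilbertSpace R).
Implicit Types (x y z : H) (a b c d s : R) (A B T X Y Z C U : operator H).

Local Notation "T ^^ a" := (locked_power T a) : ring_scope.

Lemma power_inverse T X : positive_definite T -> is_inverse T X -> T ^^ (-1) = X.
Proof.
move=> pT; apply: is_inverse_uniq.
by rewrite -{1}(power1 pT); exact: power_is_inverse.
Qed.

Lemma power_cancel T s X : positive_definite T -> T ^^ s * (T ^^ (- s) * X) = X.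
Proof. by move=> pT; rewrite mulrA -(powerD _ _ pT) subrr (power0 pT) mul1r. Qed.

Lemma power_conj_cancel T s X : positive_definite T ->
  T ^^ s * (T ^^ (- s) * X * T ^^ (- s)) * T ^^ s = X.
Proof.
move=> pT; rewrite -!mulrA (power_cancel _ _ pT) -(powerD _ _ pT) addNr (power0 pT).
by rewrite mulr1.
Qed.

Lemma power_conj_cancelV T s X : positive_definite T ->
  T ^^ (- s) * (T ^^ s * X * T ^^ s) * T ^^ (- s) = X.
Proof. by move=> pT; rewrite -{2 3}[s]opprK power_conj_cancel. Qed.

Lemma conj_is_inverse X Y C U : is_inverse X Y -> is_inverse C U ->
  is_inverse (C * X * C) (U * Y * U).
Proof.
move=> [YX XY] [UC CU]; split.
  by rewrite -[C * X * C]mulrA -mulrA (mulrA U C) UC mul1r (mulrA _ X) -(mulrA U) YX mulr1.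
by rewrite -[U * Y * U]mulrA -mulrA (mulrA C U) CU mul1r (mulrA _ Y) -(mulrA C) XY mulr1.
Qed.

Lemma power_conjV T X s : positive_definite T -> positive_definite X ->
  (T ^^ s * X * T ^^ s) ^^ (-1) = T ^^ (- s) * X ^^ (-1) * T ^^ (- s).
Proof.
move=> pT pX; have pTs := power_positive_definite s pT.
apply: power_inverse; first exact: positive_definite_conj.
apply: conj_is_inverse; last exact: power_is_inverse.
by rewrite -{1}(power1 pX); exact: power_is_inverse.
Qed.

(** Conjugate [Y >= 1] by [Y^(-1/2)]. *)
Lemma power_ge1_inv Y : positive_definite Y -> Y >=% 1 -> 1 >=% Y ^^ (-1).
Proof.
move=> pY /(operator_ge_conj (power_selfadjoint (- (1 / 2)) pY)).
rewrite mulr1 -(powerD _ _ pY) -{2}(power1 pY) -!(powerD _ _ pY).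
have -> : - (1 / 2) + 1 + - (1 / 2) = 0 :> R by lra.
have -> : - (1 / 2) + - (1 / 2) = -1 :> R by lra.
by rewrite (power0 pY).
Qed.

(** Conjugation by [B^(-1/2)] reduces to the case where the smaller operator is
    the identity. *)
Lemma operator_ge_inv A B : positive_definite A -> positive_definite B ->
  A >=% B -> B ^^ (-1) >=% A ^^ (-1).
Proof.
move=> pA pB AB; have pB2 := power_positive_definite (- (1 / 2)) pB.
have sB2 := power_selfadjoint (- (1 / 2)) pB.
have := operator_ge_conj sB2 AB.
rewrite -{4}(power1 pB) -!(powerD _ _ pB).
have -> : - (1 / 2) + 1 + - (1 / 2) = 0 :> R by lra.
rewrite (power0 pB) => /(power_ge1_inv (positive_definite_conj pB2 pA)).
rewrite (power_conjV _ pB pA) => /(operator_ge_conj sB2).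
rewrite opprK mulr1 -(powerD _ _ pB).
have -> : - (1 / 2) + - (1 / 2) = -1 :> R by lra.
by rewrite (power_conj_cancelV _ _ pB).
Qed.

(** The operator [T (C C) T] is the adjoint of [C T] times [C T]. *)
Lemma contraction_of_le1 C T : selfadjoint C -> selfadjoint T ->
  1 >=% T * (C * C) * T -> bounded_by (C * T) 1.
Proof.
move=> sC sT h x; rewrite mul1r -ler_sqr ?nnegrE ?rnorm_ge0 // -!rinnerxx.
have := operator_ge_rinner x h; rewrite !opE.
by rewrite (selfadjointP T).1 // (selfadjointP C).1.
Qed.

(** Similar operators have the same spectrum, and the spectrum of a contraction
    does not go beyond 1. *)
Lemma le1_of_similar_contraction X Y U V : selfadjoint Y -> is_inverse U V ->
  bounded_by X 1 -> X = U * Y * V -> 1 >=% Y.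
Proof.
move=> sY [VU UV] X1 XE; rewrite -(scalar_op1 H); apply: le_of_invertible => // l l1.
have l0 : 0 < l by apply: lt_trans l1.
have -> : Y - scalar_op H l = V * (X - scalar_op H l) * U.
  rewrite mulrBr mulrBl XE -scalar_opC -(mulrA _ V) VU mulr1 !mulrA VU mul1r.
  by rewrite -mulrA VU mulr1.
apply: invertibleM; last by exists V.
apply: invertibleM; first by exists U.
have -> : X - scalar_op H l = (- l)%:C%C *: (1 - (l^-1)%:C%C *: X).
  rewrite scalerBr scalerA -rmorphM mulNr mulfV ?gt_eqF // !rmorphN rmorph1 !scaleNr.
  by rewrite scale1r opprK addrC.
apply: invertibleZ; first by rewrite eq_complex /= oppr_eq0 gt_eqF.
apply: (@neumann _ _ _ l^-1); first by rewrite invr_ge0 ltW //= invf_lt1.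
move=> x; rewrite opE rnormZ ger0_norm ?invr_ge0 ?(ltW l0) // ler_pM2l ?invr_gt0 //.
by have := X1 x; rewrite mul1r.
Qed.

(** With [g] the midpoint of [s] and [s'], the operator [A^(-s/2) B^g A^(-s'/2)] is
    the product of the contractions [A^(-s/2) B^(s/2)] and [B^(s'/2) A^(-s'/2)],
    and it is conjugate to [A^(-g/2) B^g A^(-g/2)] by a power of [A]. *)
Lemma power_ge_midpoint A B s s' : positive_definite A -> positive_definite B ->
  A ^^ s >=% B ^^ s -> A ^^ s' >=% B ^^ s' ->
  A ^^ ((s + s') / 2) >=% B ^^ ((s + s') / 2).
Proof.
move=> pA pB h h'; set g := (s + s') / 2.
have n1 : bounded_by (A ^^ (- (s / 2)) * B ^^ (s / 2)) 1.
  apply: contraction_of_le1; [exact: power_selfadjoint|exact: power_selfadjoint|].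
  have := operator_ge_conj (power_selfadjoint (s / 2) pB)
    (operator_ge_inv (power_positive_definite s pA) (power_positive_definite s pB) h).
  rewrite (powerM s (-1) pB) (powerM s (-1) pA) -2!(powerD _ _ pB).
  have -> : s / 2 + s * -1 + s / 2 = 0 by lra.
  have -> : s * -1 = - (s / 2) + - (s / 2) by lra.
  rewrite (power0 pB) (powerD _ _ pA); exact: id.
have n2 : bounded_by (B ^^ (s' / 2) * A ^^ (- (s' / 2))) 1.
  apply: contraction_of_le1; [exact: power_selfadjoint|exact: power_selfadjoint|].
  have := operator_ge_conj (power_selfadjoint (- (s' / 2)) pA) h'.
  rewrite -2!(powerD _ _ pA) -(powerD _ _ pB) -splitr.
  have -> : - (s' / 2) + s' + - (s' / 2) = 0 by lra.
  rewrite (power0 pA); exact: id.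
have h1 : 1 >=% (A ^^ (- (g / 2)) * B ^^ g * A ^^ (- (g / 2))).
  (* so that -s/2 = d - g/2 and -s'/2 = -g/2 - d *)
  pose d := (s' - s) / 4.
  apply: (le1_of_similar_contraction (X := A ^^ (- (s / 2)) * B ^^ g * A ^^ (- (s' / 2)))
    _ (power_is_inverse d pA)).
  - by apply: selfadjoint_conj; exact: power_selfadjoint.
  - have -> : g = s / 2 + s' / 2 by rewrite /g; lra.
    rewrite (powerD _ _ pB) mulrA -mulrA -[X in bounded_by _ X]mulr1.
    exact: bounded_byM.
  - have -> : - (s / 2) = d + - (g / 2) by rewrite /d /g; lra.
    have -> : - (s' / 2) = - (g / 2) + - d by rewrite /d /g; lra.
    by rewrite !(powerD _ _ pA) !mulrA.
have := operator_ge_conj (power_selfadjoint (g / 2) pA) h1.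
rewrite mulr1 (power_conj_cancel _ _ pA) -(powerD _ _ pA).
by have -> : g / 2 + g / 2 = g by lra.
Qed.

Lemma power_continuous_exponent T : positive_definite T -> exists2 K : R, 0 < K &
  forall s s', 0 <= s <= 1 -> 0 <= s' <= 1 -> s != s' ->
    bounded_by (T ^^ s - T ^^ s') (K * `|s - s'|).
Proof.
move=> /positive_definite_spectrum[a [b [a0 ab abT]]].
have [K K0 hK] := powR_lipschitz_exponent b a0.
exists K => // s s' s1 s1' ss'.
apply: (interval_fcalc_bounded abT (interval_fcalcD (power_interval s a0 ab abT)
  (interval_fcalcN (power_interval s' a0 ab abT)))).
  by rewrite mulr_gt0 // normr_gt0 subr_eq0.
by move=> l hl; exact: hK.
Qed.

Lemma le_of_close (a' au bs bu k l n e : R) : bu <= au ->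
  `|2 * (bs - bu)| <= l * (n + n) -> `|2 * (a' - au)| <= k * (n + n) ->
  k * n + l * n <= e -> bs <= a' + e.
Proof.
by move=> h; rewrite !ler_norml => /andP[_ h1] /andP[h2 _] h3; lra.
Qed.

(** Bisection squeezes [s] between exponents that preserve the order, and powers
    depend continuously on the exponent. *)
Theorem loewner_heinz A B s : positive_definite A -> positive_definite B ->
  A >=% B -> 0 <= s <= 1 -> A ^^ s >=% B ^^ s.
Proof.
move=> pA pB AB s01.
have bisect n : exists u v, [/\ 0 <= u <= 1, 0 <= v <= 1, u <= s <= v, v - u = 2^-1 ^+ n &
    A ^^ u >=% B ^^ u /\ A ^^ v >=% B ^^ v].
  elim: n => [|n [u [v [u01 v01 usv vu [hu hv]]]]].
    exists 0, 1; rewrite !lexx ler01 subr0 expr0; split=> //.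
    rewrite (power0 pA) (power0 pB) (power1 pA) (power1 pB); split; last exact: AB.
    by apply: operator_ge_refl; exact: selfadjoint1.
  have hm := power_ge_midpoint pA pB hu hv.
  have vu2 : v - u = 2 * 2^-1 ^+ n.+1.
    by rewrite exprS mulrA mulfV ?mul1r // pnatr_eq0.
  move: (2^-1 ^+ n.+1 : R) vu2 => w vu2.
  case/andP: u01 => u0 u1; case/andP: v01 => v0 v1; case/andP: usv => us sv.
  have [ms|sm] := leP ((u + v) / 2) s.
    exists ((u + v) / 2), v; split=> //; try (apply/andP; split); lra.
  exists u, ((u + v) / 2); split=> //; try (apply/andP; split); lra.
have [K K0 hK] := power_continuous_exponent pA.
have [L L0 hL] := power_continuous_exponent pB.
apply/operator_geP; split; try exact: power_selfadjoint.
move=> x; set n2 := rnorm x ^+ 2.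
have n20 : 0 <= n2 by rewrite exprn_ge0 ?rnorm_ge0.
apply/ler_addgt0Pr => e e0.
pose M := (K + L) * n2 + 1.
have M0 : 0 < M by rewrite ltr_wpDl // mulr_ge0 // ltW // addr_gt0.
have [n hn] : exists n, 2^-1 ^+ n < e / M.
  have : ((2^-1 : R) ^+ n @[n --> \oo] --> 0).
    by apply: cvg_expr; rewrite ger0_norm ?invr_ge0 // invf_lt1 // ltr1n.
  move=> /cvgrPdist_lt /(_ (e / M) (divr_gt0 e0 M0)) [N _ hN].
  exists N; have := hN N (leqnn N); rewrite /= sub0r normrN ger0_norm //.
  by rewrite exprn_ge0 ?invr_ge0.
have [u [v [u01 _ /andP[us sv] vu [hu _]]]] := bisect n.
have := us; rewrite le_eqVlt => /orP[/eqP <-|us'].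
  by apply: le_trans (operator_ge_rinner x hu) _; rewrite lerDl ltW.
have ne : s != u by rewrite gt_eqF.
have su0 : 0 < `|s - u| by rewrite normr_gt0 subr_eq0.
have bound C (M' : R) : 0 < M' -> bounded_by (C ^^ s - C ^^ u) (M' * `|s - u|) ->
    `|2 * (rinner ((C ^^ s) x) x - rinner ((C ^^ u) x) x)| <= M' * `|s - u| * (n2 + n2).
  by move=> M'0 hC; rewrite -rinnerBl; exact: rinner_bounded (mulr_gt0 M'0 su0) hC.
apply: (le_of_close (operator_ge_rinner x hu) (bound B L L0 (hL s u s01 u01 ne))
  (bound A K K0 (hK s u s01 u01 ne))).
have su : `|s - u| * M <= e.
  rewrite -ler_pdivlMr //; apply: le_trans (ltW hn); rewrite -vu ger0_norm ?lerD2r //.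
  by rewrite subr_ge0.
apply: le_trans su; rewrite /M mulrDr mulr1 mulrDl mulrDr -addrA.
by rewrite (mulrC K) (mulrC L) -!mulrA lerD2l lerDl normr_ge0.
Qed.

Definition furuta A B p r :=
  A ^^ (1 + r) >=% (A ^^ (r / 2) * B ^^ p * A ^^ (r / 2)) ^^ ((1 + r) / (p + r)).

(** Let [X = A^(r/2) B^(p/2)] and [Y = B^(p/2) A^(r/2)]. The right side is
    [X (YX)^(-mu) Y] with [mu = (p-1)/(p+r)] in [0, 1]. Since [A^r >= B^r], the
    middle operator [YX = B^(p/2) A^r B^(p/2)] is at least [B^(p+r)], so the whole
    is at most [A^(r/2) B A^(r/2) <= A^(1+r)]. *)
Lemma furuta_small A B p r : positive_definite A -> positive_definite B ->
  A >=% B -> 1 <= p -> 0 <= r <= 1 -> furuta A B p r.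
Proof.
move=> pA pB AB p1 /andP[r0 r1].
pose X := A ^^ (r / 2) * B ^^ (p / 2); pose Y := B ^^ (p / 2) * A ^^ (r / 2).
have XYE : X * Y = A ^^ (r / 2) * B ^^ p * A ^^ (r / 2).
  by rewrite /X /Y mulrA -(mulrA (A ^^ _)) -(powerD (p / 2) (p / 2) pB) -splitr.
have YXE : Y * X = B ^^ (p / 2) * A ^^ r * B ^^ (p / 2).
  by rewrite /X /Y mulrA -(mulrA (B ^^ _)) -(powerD (r / 2) (r / 2) pA) -splitr.
have pXY : positive_definite (X * Y).
  by rewrite XYE; apply: positive_definite_conj; exact: power_positive_definite.
have pYX : positive_definite (Y * X).
  by rewrite YXE; apply: positive_definite_conj; exact: power_positive_definite.
have pr : 0 < p + r by lra.
rewrite /furuta -XYE (power_mulC _ pXY pYX).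
have YXB : (Y * X) >=% B ^^ (p + r).
  have r01 : 0 <= r <= 1 by rewrite r0.
  have := operator_ge_conj (power_selfadjoint (p / 2) pB) (loewner_heinz pA pB AB r01).
  rewrite YXE -!(powerD _ _ pB).
  by have -> : p / 2 + r + p / 2 = p + r by lra.
pose mu := (p - 1) / (p + r).
have mu01 : 0 <= mu <= 1.
  by rewrite divr_ge0 ?subr_ge0 //= ?(ltW pr) // ler_pdivrMr // mul1r; lra.
have := loewner_heinz pYX (power_positive_definite (p + r) pB) YXB mu01.
rewrite (powerM _ _ pB).
move=> /(operator_ge_inv (power_positive_definite _ pYX) (power_positive_definite _ pB)).
rewrite (powerM _ _ pYX) (powerM _ _ pB).
have -> : mu * -1 = (1 + r) / (p + r) - 1 by rewrite /mu; field; rewrite gt_eqF.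
have -> : (p + r) * mu * -1 = 1 - p by rewrite /mu; field; rewrite gt_eqF.
move=> /(operator_ge_conj (power_selfadjoint (p / 2) pB)).
move=> /(operator_ge_conj (power_selfadjoint (r / 2) pA)).
rewrite -!(powerD _ _ pB).
have -> : p / 2 + (1 - p) + p / 2 = 1 by lra.
rewrite (power1 pB) => h.
have := operator_ge_conj (power_selfadjoint (r / 2) pA) AB.
rewrite -{2}(power1 pA) -!(powerD _ _ pA).
have -> : r / 2 + 1 + r / 2 = 1 + r by lra.
move=> /operator_ge_trans; apply.
move: h; rewrite /X /Y !mulrA; exact: id.
Qed.

(** The conclusion of one inequality serves as the hypothesis of the next, with
    the exponents multiplied out. *)
Lemma furuta_compose A B p r p' r' : positive_definite A -> positive_definite B ->
  let A' := A ^^ (1 + r) in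
  let B' := (A ^^ (r / 2) * B ^^ p * A ^^ (r / 2)) ^^ ((1 + r) / (p + r)) in
  furuta A' B' p' r' ->
  A ^^ ((1 + r) * (1 + r')) >=%
  (A ^^ ((1 + r) * r' / 2) *
   (A ^^ (r / 2) * B ^^ p * A ^^ (r / 2)) ^^ ((1 + r) / (p + r) * p') *
   A ^^ ((1 + r) * r' / 2)) ^^ ((1 + r') / (p' + r')).
Proof.
move=> pA pB /=; rewrite /furuta.
have pM : positive_definite (A ^^ (r / 2) * B ^^ p * A ^^ (r / 2)).
  by apply: positive_definite_conj; exact: power_positive_definite.
by rewrite !(powerM _ _ pM) !(powerM _ _ pA) !mulrA.
Qed.

(** Composing the inequality for [q = (r-1)/2] with the one for exponent 1 gives
    [1 + r = 2 (1 + q)]. *)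
Theorem furuta_inequality A B p r : positive_definite A -> positive_definite B ->
  A >=% B -> 1 <= p -> 0 <= r -> furuta A B p r.
Proof.
move=> pA pB AB p1 r0.
have [n rn] : exists n, r < n%:R.
  by exists (Num.truncn r).+1; exact: truncnS_gt.
elim: n r r0 rn => [|n IH] r r0 rn; first by move: rn; rewrite ltNge r0.
have [r1|r1] := leP r 1; first by apply: furuta_small => //; rewrite r0.
pose q := (r - 1) / 2.
have q0 : 0 <= q by rewrite /q; lra.
have hq : furuta A B p q.
  by apply: IH => //; move: rn; rewrite -natr1 /q; have := ler0n R n; lra.
have pr : 0 < p + r by lra.
have pq : 0 < p + q by rewrite /q; lra.
have q1 : 0 < 1 + q by lra.
have pM : positive_definite (A ^^ (q / 2) * B ^^ p * A ^^ (q / 2)).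
  by apply: positive_definite_conj; exact: power_positive_definite.
pose p' := (p + q) / (1 + q).
have p1' : 1 <= p' by rewrite ler_pdivlMr // mul1r; lra.
(* p' is chosen so that the middle factor returns to its first power *)
have := furuta_compose pA pB (furuta_small (power_positive_definite _ pA)
   (power_positive_definite _ pM) hq p1' (_ : 0 <= 1 <= 1)).
rewrite lexx ler01 => /(_ isT).
have -> : (1 + q) / (p + q) * p' = 1 by rewrite /p'; field; rewrite !gt_eqF.
rewrite (power1 pM) !mulrA -(powerD _ _ pA) -!mulrA -(powerD _ _ pA) !mulrA.
have -> : (1 + q) * (1 + 1) = 1 + r by rewrite /q; lra.
have -> : (1 + q) * 1 / 2 + q / 2 = r / 2 by rewrite /q; lra.
have -> : q / 2 + (1 + q) * 1 / 2 = r / 2 by rewrite /q; lra.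
have -> : (1 + 1) / (p' + 1) = (1 + r) / (p + r).
  have e : 2 * q + 1 = r by rewrite /q; lra.
  rewrite /p' -e; field.
  rewrite !gt_eqF //; lra.
by [].
Qed.

(** The exponent [s (p+t)/(1+t)] of the second application is at least 1 because
    [n + 1 >= 1]. *)
Lemma admissible_bounds r t p s n : admissible r t p s n ->
  [/\ 0 < s, 0 < p + t, 0 < 1 + t & 1 <= s * (p + t) / (1 + t)].
Proof.
move=> [r0 t0 p1 E].
have pt : 0 < p + t by lra.
have t1 : 0 < 1 + t by lra.
have n1 : 1 <= (n.+1%:R : R) by rewrite ler1n.
have h : 1 + t <= (p + t) * s by move: (n.+1%:R : R) n1 E => N n1 E; nra.
have s0 : 0 < s by rewrite -(pmulr_rgt0 _ pt); lra.
by split=> //; rewrite ler_pdivlMr // mul1r mulrC.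
Qed.

(** Furuta's inequality for [A], [B] and the exponents [p], [t], followed by the
    one for the two sides of the result. *)
Theorem grand_furuta A B r t p s n : positive_definite A -> positive_definite B ->
  A >=% B -> admissible r t p s n ->
  A ^^ (1 + t + r) >=%
      (A ^^ (r / 2) * (A ^^ (t / 2) * B ^^ p * A ^^ (t / 2)) ^^ s
        * A ^^ (r / 2)) ^^ (n.+1%:R^-1).
Proof.
move=> pA pB AB adm; have [s0 pt t1 ps] := admissible_bounds adm.
case: adm => r0 t0 p1 E; have trs : 0 < 1 + t + r by lra.
have pM : positive_definite (A ^^ (t / 2) * B ^^ p * A ^^ (t / 2)).
  by apply: positive_definite_conj; exact: power_positive_definite.
pose p' := s * (p + t) / (1 + t); pose r' := r / (1 + t).
have r0' : 0 <= r' by rewrite divr_ge0 // ltW.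
have := furuta_compose pA pB (furuta_inequality (power_positive_definite _ pA)
   (power_positive_definite _ pM) (furuta_inequality pA pB AB p1 t0) ps r0').
have -> : (1 + t) / (p + t) * (s * (p + t) / (1 + t)) = s by field; rewrite !gt_eqF.
have -> : (1 + t) * (1 + r') = 1 + t + r by rewrite /r'; field; rewrite gt_eqF.
have -> : (1 + t) * r' / 2 = r / 2 by rewrite /r'; field; rewrite gt_eqF.
have -> : (1 + r') / (s * (p + t) / (1 + t) + r') = n.+1%:R^-1.
  have E' : s * (p + t) + r = n.+1%:R * (1 + t + r) by rewrite -E; ring.
  have N0 : 0 < (n.+1%:R : R) by rewrite ltr0n.
  move: (n.+1%:R : R) N0 E' => N N0 E'.
  have -> : s * (p + t) / (1 + t) + r' = N * (1 + t + r) / (1 + t).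
    by rewrite -E' /r' -mulrDl.
  by rewrite /r'; field; rewrite !gt_eqF.
by [].
Qed.

End Inequalities.

(** * The word equation and the equivalences *)

Section Equivalences.
Variables (R : realType) (H : hilbertSpace R).
Implicit Types (x y z : H) (a b c d r t p s : R) (A B T X Y Z C S U : operator H).

Local Notation "T ^^ a" := (locked_power T a) : ring_scope.

Definition furuta_word A B r t p s : operator H :=
  A ^^ (r / 2) * (A ^^ (t / 2) * B ^^ p * A ^^ (t / 2)) ^^ s * A ^^ (r / 2).

Lemma furuta_word_pd A B r t p s : positive_definite A -> positive_definite B ->
  positive_definite (furuta_word A B r t p s).
Proof.
move=> pA pB; apply: positive_definite_conj; first exact: power_positive_definite.
apply: power_positive_definite; apply: positive_definite_conj;
  exact: power_positive_definite.
Qed.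

(** This is [grand_furuta] for [B^(-1) >= A^(-1)], inverted. *)
Lemma grand_furuta_dual A B r t p s n : positive_definite A -> positive_definite B ->
  A >=% B -> admissible r t p s n ->
  (furuta_word B A r t p s) ^^ (n.+1%:R^-1) >=% B ^^ (1 + t + r).
Proof.
move=> pA pB AB adm.
have pAV := power_positive_definite (-1) pA; have pBV := power_positive_definite (-1) pB.
have pM : positive_definite (B ^^ (t / 2) * A ^^ p * B ^^ (t / 2)).
  by apply: positive_definite_conj; exact: power_positive_definite.
have := grand_furuta pBV pAV (operator_ge_inv pA pB AB) adm.
have -> : (B ^^ (-1)) ^^ (r / 2) * ((B ^^ (-1)) ^^ (t / 2) * (A ^^ (-1)) ^^ p
    * (B ^^ (-1)) ^^ (t / 2)) ^^ s * (B ^^ (-1)) ^^ (r / 2) =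
    (furuta_word B A r t p s) ^^ (-1).
  rewrite /furuta_word power_conjV //; last exact: power_positive_definite.
  rewrite (powerM _ _ pM) (mulrC s) -(powerM _ _ pM) power_conjV //; last first.
    exact: power_positive_definite.
  by rewrite !powerM // !mulN1r mulrN1.
have pK := furuta_word_pd r t p s pB pA.
move=> /(operator_ge_inv (power_positive_definite _ pBV)
  (power_positive_definite _ (power_positive_definite _ pK))).
rewrite !powerM //; last exact: power_positive_definite.
by rewrite !mulrN1 !mulN1r !opprK.
Qed.

Lemma expr_mulC S D n : (S * D) ^+ n * S = S * (D * S) ^+ n :> operator H.
Proof.
elim: n => [|n IH]; first by rewrite !expr0 mul1r mulr1.
by rewrite !exprS -mulrA IH !mulrA.
Qed.

(** Both sides read D S D D S D ... D S D. *)
Lemma conj_exprS S D n : D * (S * (D * D)) ^+ n * S * D = (D * S * D) ^+ n.+1 :> operator H.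
Proof.
elim: n => [|n IH]; first by rewrite expr0 expr1 mulr1.
by rewrite exprS [RHS]exprS -IH !mulrA.
Qed.

(** The candidate solution [D^(-1/2) K^(1/(n+1)) D^(-1/2)], where [D] is
    [A^(1+t+r)] and [K] is the word above. *)
Definition word_root A B r t p s n : operator H :=
  A ^^ (- ((1 + t + r) / 2)) * (furuta_word A B r t p s) ^^ (n.+1%:R^-1)
    * A ^^ (- ((1 + t + r) / 2)).

Lemma word_root_pd A B r t p s n : positive_definite A -> positive_definite B ->
  positive_definite (word_root A B r t p s n).
Proof.
move=> pA pB; apply: positive_definite_conj; first exact: power_positive_definite.
by apply: power_positive_definite; exact: furuta_word_pd.
Qed.

(** Let [W] be the word inside the power [1/s] and [Z = D^(1/2) S D^(1/2)] with
    [D = A^(1+t+r)]. As [D^(1/2) = A^(r/2) A^((1+t)/2)], conjugating [W] by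
    [A^(r/2)] gives [Z^(n+1)]; in particular [W] is positive definite, so its
    powers can be cancelled. *)
Lemma word_equation A B S r t p s n : positive_definite A -> positive_definite B ->
  positive_definite S -> s != 0 ->
  B ^^ p = A ^^ (- (t / 2))
              * (A ^^ ((1 + t) / 2) * (S * A ^^ (1 + t + r)) ^+ n
                  * S * A ^^ ((1 + t) / 2)) ^^ (s^-1)
              * A ^^ (- (t / 2)) <->
  S = word_root A B r t p s n.
Proof.
move=> pA pB pS s0.
set G := A ^^ ((1 + t) / 2); set W := G * _ * _ * _.
rewrite /word_root; set d := (1 + t + r) / 2; set Z := A ^^ d * S * A ^^ d.
have n0 : n.+1%:R != 0 :> R by rewrite pnatr_eq0.
have pZ : positive_definite Z.
  by apply: positive_definite_conj => //; exact: power_positive_definite.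
have WZ : A ^^ (r / 2) * W * A ^^ (r / 2) = Z ^+ n.+1.
  rewrite -conj_exprS -(powerD _ _ pA) -splitr /W /G !mulrA -powerD //.
  rewrite -!mulrA -powerD // !mulrA.
  by congr (A ^^ _ * _ * _ * A ^^ _); rewrite /d; lra.
have pW : positive_definite W.
  have -> : W = A ^^ (- (r / 2)) * Z ^+ n.+1 * A ^^ (- (r / 2)).
    by rewrite -WZ power_conj_cancelV.
  by apply: positive_definite_conj; rewrite -?power_nat //; exact: power_positive_definite.
have pM : positive_definite (A ^^ (t / 2) * B ^^ p * A ^^ (t / 2)).
  by apply: positive_definite_conj; exact: power_positive_definite.
have pK := furuta_word_pd r t p s pA pB.
split=> [E|E].
  have MW : A ^^ (t / 2) * B ^^ p * A ^^ (t / 2) = W ^^ s^-1.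
    by rewrite E power_conj_cancel.
  by rewrite /furuta_word MW powerVK // WZ -power_nat // powerK // power_conj_cancelV.
have KZ : furuta_word A B r t p s = Z ^+ n.+1.
  rewrite -power_nat // /Z E power_conj_cancel // powerVK //.
have MW : (A ^^ (t / 2) * B ^^ p * A ^^ (t / 2)) ^^ s = W.
  rewrite -[LHS](power_conj_cancelV (r / 2) _ pA) -/(furuta_word _ _ _ _ _ _).
  by rewrite KZ -WZ power_conj_cancelV.
by rewrite -MW powerK // power_conj_cancelV.
Qed.

Lemma word_equation_shift A S r t n :
  A ^^ ((1 + t) / 2) * S * (A ^^ (1 + t + r) * S) ^+ n =
  A ^^ ((1 + t) / 2) * (S * A ^^ (1 + t + r)) ^+ n * S.
Proof. by rewrite -mulrA -expr_mulC mulrA. Qed.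

Lemma operator_norm_le1 S : positive_definite S -> operator_norm S <= 1 <-> 1 >=% S.
Proof.
move=> pS; have sS := positive_definite_selfadjoint pS.
rewrite operator_normP // -(scalar_op1 H); split=> [h|h].
  exact: (bounded_by_ge ltr01 sS h).1.
apply: bounded_by_selfadjoint => //; apply: operator_ge_trans (_ : _ >=% 0) _.
  by apply/positive_ge0; exact: pS.1.
by rewrite -(scalar_op0 H); apply: operator_ge_scalar; rewrite oppr_le0 ler01.
Qed.

Lemma operator_invE S : positive_definite S -> operator_inv S = S ^^ (-1).
Proof.
move=> pS; apply/esym; apply: power_inverse => //.
by apply: (xgetPex (P := is_inverse S) 0); exact: pS.2.
Qed.

Lemma power_invK S : positive_definite S -> (S ^^ (-1)) ^^ (-1) = S.
Proof. by move=> pS; rewrite powerM // mulrNN mulr1 power1. Qed.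

Lemma power_half_mul A c : positive_definite A -> A ^^ (c / 2) * A ^^ (c / 2) = A ^^ c.
Proof. by move=> pA; rewrite -powerD // -splitr. Qed.

Lemma power_half_conj A c : positive_definite A ->
  A ^^ (- (c / 2)) * A ^^ c * A ^^ (- (c / 2)) = 1.
Proof.
move=> pA; rewrite -!powerD //.
have -> : - (c / 2) + c + - (c / 2) = 0 by lra.
exact: power0.
Qed.

Lemma ge_conj_half A C c : positive_definite A ->
  A ^^ c >=% C <-> 1 >=% A ^^ (- (c / 2)) * C * A ^^ (- (c / 2)).
Proof.
move=> pA; split=> h.
  have := operator_ge_conj (power_selfadjoint (- (c / 2)) pA) h.
  by rewrite power_half_conj.
have := operator_ge_conj (power_selfadjoint (c / 2) pA) h.
by rewrite mulr1 power_half_mul // power_conj_cancel.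
Qed.

Lemma conj_half_ge A C c : positive_definite A ->
  C >=% A ^^ c <-> A ^^ (- (c / 2)) * C * A ^^ (- (c / 2)) >=% 1.
Proof.
move=> pA; split=> h.
  have := operator_ge_conj (power_selfadjoint (- (c / 2)) pA) h.
  by rewrite power_half_conj.
have := operator_ge_conj (power_selfadjoint (c / 2) pA) h.
by rewrite mulr1 power_half_mul // power_conj_cancel.
Qed.

Lemma power_le1_inv S : positive_definite S -> 1 >=% S -> S ^^ (-1) >=% 1.
Proof.
move=> pS /(operator_ge_inv _ pS) h.
have p1 : positive_definite (1 : operator H).
  by rewrite -(power0 pS); exact: power_positive_definite.
have := h p1.
by rewrite (power_inverse p1 (_ : is_inverse 1 1)) //; split; rewrite mulr1.
Qed.

Lemma word_solution A B r t p s n : positive_definite A -> positive_definite B ->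
  admissible r t p s n ->
  A ^^ (1 + t + r) >=% (furuta_word A B r t p s) ^^ (n.+1%:R^-1) ->
  exists! S : operator H,
        [/\ positive_definite S, operator_norm S <= 1,
            B ^^ p = A ^^ (- (t / 2))
              * (A ^^ ((1 + t) / 2) * (S * A ^^ (1 + t + r)) ^+ n
                  * S * A ^^ ((1 + t) / 2)) ^^ (s^-1)
              * A ^^ (- (t / 2))
          & B ^^ p = A ^^ (- (t / 2))
              * (A ^^ ((1 + t) / 2) * S * (A ^^ (1 + t + r) * S) ^+ n
                  * A ^^ ((1 + t) / 2)) ^^ (s^-1)
              * A ^^ (- (t / 2))].
Proof.
move=> pA pB adm h; have [s0 _ _ _] := admissible_bounds adm.
have sn0 : s != 0 by rewrite gt_eqF.
have pS := word_root_pd r t p s n pA pB.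
have eS := (word_equation r t p n pA pB pS sn0).2 erefl.
exists (word_root A B r t p s n); split.
  split=> //; last by rewrite word_equation_shift.
  by apply/operator_norm_le1 => //; exact/ge_conj_half.
by move=> S [pS' _ /(word_equation r t p n pA pB pS' sn0) -> _].
Qed.

Lemma inverse_word_solution A B r t p s n : positive_definite A -> positive_definite B ->
  admissible r t p s n ->
  (furuta_word A B r t p s) ^^ (n.+1%:R^-1) >=% A ^^ (1 + t + r) ->
  exists! S : operator H,
        [/\ positive_definite S, operator_norm S <= 1,
            B ^^ p = A ^^ (- (t / 2))
              * (A ^^ ((1 + t) / 2)
                  * (operator_inv S * A ^^ (1 + t + r)) ^+ n
                  * operator_inv S * A ^^ ((1 + t) / 2)) ^^ (s^-1)
              * A ^^ (- (t / 2))
          & B ^^ p = A ^^ (- (t / 2))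
              * (A ^^ ((1 + t) / 2) * operator_inv S
                  * (A ^^ (1 + t + r) * operator_inv S) ^+ n
                  * A ^^ ((1 + t) / 2)) ^^ (s^-1)
              * A ^^ (- (t / 2))].
Proof.
move=> pA pB adm h; have [s0 _ _ _] := admissible_bounds adm.
have sn0 : s != 0 by rewrite gt_eqF.
have pT := word_root_pd r t p s n pA pB.
have eT := (word_equation r t p n pA pB pT sn0).2 erefl.
have pTV := power_positive_definite (-1) pT.
exists (word_root A B r t p s n ^^ (-1)); split.
  rewrite operator_invE // power_invK //.
  split=> //; last by rewrite word_equation_shift.
  by apply/operator_norm_le1 => //; apply: power_ge1_inv => //; exact/conj_half_ge.
move=> S [pS _ + _]; rewrite operator_invE //.
move=> /(word_equation r t p n pA pB (power_positive_definite (-1) pS) sn0) <-.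
exact: power_invK.
Qed.

Lemma admissible_trivial : admissible (0 : R) 0 1 1 0.
Proof. by split; rewrite ?lexx // !addr0 !mul1r. Qed.

Lemma furuta_word_trivial A B : positive_definite A -> positive_definite B ->
  (furuta_word A B 0 0 1 1) ^^ (1%:R^-1) = B.
Proof.
move=> pA pB; rewrite /furuta_word mul0r !power0 // !mul1r !mulr1 invr1.
by rewrite !power1.
Qed.

Lemma power_trivial A : positive_definite A -> A ^^ (1 + 0 + 0) = A.
Proof. by move=> pA; rewrite !addr0 power1. Qed.

End Equivalences.

Theorem theorem2p1 (R : realType) (H : hilbertSpace R) (A B : operator H)
    (hA : positive_definite A) (hB : positive_definite B) :
  [<->
    (* C1 *)
    A >=% B /\ positive_definite B ;
    (* C2 *)
    forall (r t p s : R) (n : nat), admissible r t p s n ->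
      A ^^ (1 + t + r) >=%
      (A ^^ (r / 2) * (A ^^ (t / 2) * B ^^ p * A ^^ (t / 2)) ^^ s
        * A ^^ (r / 2)) ^^ (n.+1%:R^-1) ;
    (* C3 *)
    forall (r t p s : R) (n : nat), admissible r t p s n ->
      (B ^^ (r / 2) * (B ^^ (t / 2) * A ^^ p * B ^^ (t / 2)) ^^ s
        * B ^^ (r / 2)) ^^ (n.+1%:R^-1)
      >=% B ^^ (1 + t + r) ;
    (* C4 *)
    forall (r t p s : R) (n : nat), admissible r t p s n ->
      exists! S : operator H,
        [/\ positive_definite S, operator_norm S <= 1,
            B ^^ p = A ^^ (- (t / 2))
              * (A ^^ ((1 + t) / 2) * (S * A ^^ (1 + t + r)) ^+ n
                  * S * A ^^ ((1 + t) / 2)) ^^ (s^-1)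
              * A ^^ (- (t / 2))
          & B ^^ p = A ^^ (- (t / 2))
              * (A ^^ ((1 + t) / 2) * S * (A ^^ (1 + t + r) * S) ^+ n
                  * A ^^ ((1 + t) / 2)) ^^ (s^-1)
              * A ^^ (- (t / 2))] ;
    (* C5 *)
    forall (r t p s : R) (n : nat), admissible r t p s n ->
      exists! S : operator H,
        [/\ positive_definite S, operator_norm S <= 1,
            A ^^ p = B ^^ (- (t / 2))
              * (B ^^ ((1 + t) / 2)
                  * (operator_inv S * B ^^ (1 + t + r)) ^+ n
                  * operator_inv S * B ^^ ((1 + t) / 2)) ^^ (s^-1)
              * B ^^ (- (t / 2))
          & A ^^ p = B ^^ (- (t / 2))
              * (B ^^ ((1 + t) / 2) * operator_inv S
                  * (B ^^ (1 + t + r) * operator_inv S) ^+ n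
                  * B ^^ ((1 + t) / 2)) ^^ (s^-1)
              * B ^^ (- (t / 2))] ].
Proof.
have one0 : (1 : R) != 0 by exact: oner_neq0.
have triv := admissible_trivial R.
rewrite -(locked_powerE H).
tfae.
- by move=> [AB _] r t p s n; exact: grand_furuta.
- move=> h r t p s n; apply: grand_furuta_dual => //.
  by have := h _ _ _ _ _ triv; rewrite power_trivial // furuta_word_trivial.
- move=> h r t p s n adm; apply: word_solution => //; apply: grand_furuta => //.
  by have := h _ _ _ _ _ triv; rewrite power_trivial // furuta_word_trivial.
- move=> h r t p s n adm; apply: inverse_word_solution => //.
  apply: grand_furuta_dual => //.
  have [S [[pS S1 /(word_equation 0 0 1 0 hA hB pS one0) SE _] _]] := h _ _ _ _ _ triv.
  move/(operator_norm_le1 pS): S1; rewrite SE => /(ge_conj_half _ _ hA).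
  by rewrite power_trivial // furuta_word_trivial.
- move=> h; split=> //.
  have [S [[pS S1 e _] _]] := h _ _ _ _ _ triv.
  move: e; rewrite operator_invE // => e.
  have SE := (word_equation 0 0 1 0 hB hA (power_positive_definite (-1) pS) one0).1 e.
  move/(operator_norm_le1 pS)/(power_le1_inv pS): S1.
  rewrite SE => /(conj_half_ge _ _ hB).
  by rewrite power_trivial // furuta_word_trivial.
Qed.
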